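(* The algebra $\mathrm{Peak}^*$ of peak quasisymmetric functions is free as a module over its subalgebra $\Omega$.
   Context: Let $\mathbb K$ be an algebraically closed field of characteristic $0$. $\mathrm{QSym}\subseteq\mathbb K[[x_1,x_2,\dots]]$ is the $\mathbb K$-algebra of quasisymmetric functions. For a composition $\alpha=(\alpha_1,\dots,\alpha_r)\vDash n$, $D(\alpha)=\{\alpha_1,\alpha_1+\alpha_2,\dots,\alpha_1+\cdots+\alpha_{r-1}\}\subseteq[n-1]$, and the fundamental quasisymmetric function is $F_\alpha=\sum x_{i_1}\cdots x_{i_n}$, summed over $i_1\le\cdots\le i_n$ with $i_k<i_{k+1}$ whenever $k\in D(\alpha)$. A peak set in $[n]$ is a subset $P\subseteq\{2,\dots,n-1\}$ with $i\in P\Rightarrow i-1\notin P$. For such $P$, Stembridge's peak function is $$K_P=2^{|P|+1}\sum_{\alpha\vDash n,\;P\subseteq D(\alpha)\triangle(D(\alpha)+1)}F_\alpha,$$ where $D+1=\{x+1:x\in D\}$ and $\triangle$ is symmetric difference. $\mathrm{Peak}^*$ (the Stembridge algebra) is the $\mathbb K$-span of $1$ and all $K_P$ ($P$ a peak set in $[n]$, $n\ge1$); it is a (Hopf) subalgebra of $\mathrm{QSym}$. $\Omega$ is the $\mathbb K$-subalgebra of symmetric functions generated by $q_n$ ($n\ge1$), where $\sum_{n\ge0}q_nz^n=\prod_{i\ge1}\frac{1+x_iz}{1-x_iz}$ (the subring spanned by Schur's Q-functions); $q_n=K_{\emptyset}$ for $\emptyset$ regarded as a peak set in $[n]$, so $\Omega\subseteq\mathrm{Peak}^*$.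 *)

(* Defs.v *)
From HB Require Import structures.
From mathcomp Require Import all_boot all_algebra.
From mathcomp Require Import ring finmap multiset.
From mathcomp Require Import boolp classical_sets functions.

Set Implicit Arguments.
Unset Strict Implicit.
Unset Printing Implicit Defensive.

Import GRing.Theory.
Local Open Scope ring_scope.

(* A monomial in the variables x_0, x_1, x_2, ... is a finite multiset of
   indices: m i is the exponent of x_i and size m is the degree.  Indices start
   at 0, so x_i here is the usual x_(i+1). *)
Notation monomial := {mset nat}%mset.

Definition mdivisors (m : monomial) : {fset monomial} :=
  [fset seq_mset (mask (tval b) m) | b in {: (size m).-tuple bool}]%fset.

Lemma in_mdivisors (a m : monomial) : (a \in mdivisors m) = (a `<=` m)%mset.
Proof.
apply/imfsetP/msubsetP => [[b _ -> i]|le_am].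
  by rewrite mset_seqE -count_mem_mset leq_count_subseq // mask_subseq.
have /count_subseqP[s /subseqP[b sz_b def_s] perm_as] :
    forall i, (count_mem i a <= count_mem i m)%N.
  by move=> i; rewrite !count_mem_mset.
exists (tcast sz_b (in_tuple b)); first by [].
rewrite val_tcast /= -def_s -[LHS]seq_mset_id.
exact/eq_seq_msetP.
Qed.

(* K[[x_0, x_1, ...]] : a series is the family of its coefficients. *)
Definition series (K : Type) : Type := monomial -> K.

HB.instance Definition _ (K : comNzRingType) :=
  GRing.Lmodule.copy (series K) (monomial -> K^o).

Section SeriesRing.
Variable K : comNzRingType.
Implicit Types (f g h : series K) (a b m : monomial).
Local Open Scope mset_scope.

Definition series_one : series K := fun m => (m == mset0)%:R.

Definition series_mul f g : series K :=
  fun m => \sum_(a <- mdivisors m) f a * g (m `\` a).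

Lemma series_mulC : commutative series_mul.
Proof.
move=> f g; apply/funext => m; rewrite /series_mul.
have inj : {in mdivisors m &, injective (msetB m)}.
  move=> a b; rewrite !in_mdivisors => am bm eq_ab.
  by rewrite -(msetBBK am) eq_ab msetBBK.
have im : [fset (m `\` a)%mset | a in mdivisors m]%fset = mdivisors m.
  apply/fsetP => a; apply/imfsetP/idP => [[b _ ->]|] /=.
    by rewrite in_mdivisors; apply/msubsetP => i; rewrite msetE2 leq_subr.
  rewrite in_mdivisors => am; exists (m `\` a); last by rewrite msetBBK.
  by rewrite /= in_mdivisors; apply/msubsetP => i; rewrite msetE2 leq_subr.
rewrite -[in LHS]im big_imfset //=.
rewrite big_seq [RHS]big_seq; apply: eq_bigr => a.
by rewrite in_mdivisors => am; rewrite msetBBK // mulrC.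
Qed.

Lemma series_mul1 : left_id series_one series_mul.
Proof.
move=> f; apply/funext => m; rewrite /series_mul /series_one.
rewrite (big_fsetD1 mset0) /=; last by rewrite in_mdivisors msub0set.
rewrite eqxx mul1r msetB0 big_seq big1 ?addr0 // => a.
by rewrite !inE => /andP[/negPf-> _]; rewrite mul0r.
Qed.

Lemma series_mulDl : left_distributive series_mul +%R.
Proof.
move=> f g h; apply/funext => m.
transitivity (series_mul f h m + series_mul g h m); last by [].
by rewrite /series_mul -big_split /=; apply: eq_bigr => a _; rewrite -mulrDl.
Qed.

Lemma series_mulA : associative series_mul.
Proof.
move=> f g h; apply/funext => m; rewrite /series_mul.
transitivity (\sum_(a <- mdivisors m) \sum_(c <- mdivisors m | a `<=` c)
    f a * g (c `\` a) * h (m `\` c)).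
  rewrite big_seq [RHS]big_seq; apply: eq_bigr => a.
  rewrite in_mdivisors => am; rewrite big_distrr /=.
  rewrite [RHS]big_fset_condE /=.
  pose E := [fset (a `+` b)%mset | b in mdivisors (m `\` a)%mset]%fset.
  transitivity (\sum_(c <- E) f a * g (c `\` a) * h (m `\` c)).
    rewrite [RHS]big_imfset /=; last first.
      by move=> b c _ _; apply: (can_inj (@msetDKB _ a)).
    by apply: eq_bigr => b _; rewrite msetDKB msetBDA mulrA.
  apply: eq_fbigl => c; rewrite !inE /= in_mdivisors.
  apply/imfsetP/andP => [[b /=]|[cm ac]].
    rewrite in_mdivisors => bm ->; split; last first.
      by apply/msubsetP => i; rewrite msetE2 leq_addr.
    by rewrite -(msetBDKC am) msetDS.
  exists (c `\` a); last by rewrite msetBDKC.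
  by rewrite /= in_mdivisors msetSB.
rewrite (exchange_big_dep xpredT) //= big_seq [RHS]big_seq.
apply: eq_bigr => c; rewrite in_mdivisors => cm.
rewrite big_distrl /= [LHS]big_fset_condE /=; apply: eq_fbigl => a.
rewrite !inE /= !in_mdivisors.
by apply/andP/idP => [[]//|ac]; split=> //; apply: msubset_trans cm.
Qed.

Lemma series_one_neq0 : series_one != 0.
Proof.
apply/eqP => /(congr1 (fun f : series K => f mset0)) /eqP.
by rewrite /series_one eqxx oner_eq0.
Qed.

HB.instance Definition _ := GRing.Zmodule_isComNzRing.Build (series K)
  series_mulA series_mulC series_mul1 series_mulDl series_one_neq0.

Lemma series_scaleAl (c : K) (f g : series K) : c *: (f * g) = (c *: f) * g.
Proof.
apply/funext => m.
transitivity (c * series_mul f g m); first by [].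
by rewrite /series_mul big_distrr; apply: eq_bigr => a _; apply: mulrA.
Qed.

HB.instance Definition _ :=
  GRing.Lmodule_isLalgebra.Build K (series K) series_scaleAl.
HB.instance Definition _ := GRing.Lalgebra_isComAlgebra.Build K (series K).

Definition series_var (i : nat) : series K := fun m => (m == [mset i])%:R.

End SeriesRing.

Section PeakFunctions.
Variable K : comNzRingType.
Local Open Scope fset_scope.

Definition is_composition (n : nat) (a : seq nat) : bool :=
  (0%N \notin a) && (sumn a == n).

Definition descents (a : seq nat) : {fset nat} :=
  [fset sumn (take k a) | k in iota 1 (size a).-1].

(* Each monomial m of degree n is x_(i_1)...x_(i_n) for exactly one weakly
   increasing sequence i, namely the sorted listing of m; so the coefficient of
   m in F_a is 1 or 0 according to whether this sequence is admissible.  In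
   1-based indexing, i_k is nth 0 s k.-1 and i_(k+1) is nth 0 s k. *)
Definition fundamental (a : seq nat) : series K := fun m =>
  let s := sort leq m in
  ((size s == sumn a) &&
   all (fun k => nth 0 s k.-1 < nth 0 s k)%N (descents a))%:R.

Definition is_peak_set (n : nat) (P : {fset nat}) : Prop :=
  forall i, i \in P -> (2 <= i <= n.-1)%N /\ i.-1 \notin P.

Definition sym_diff (A B : {fset nat}) : {fset nat} := (A `\` B) `|` (B `\` A).

(* A composition of n has at most n parts, each at most n, so it is listed
   exactly once among the a : n.-bseq 'I_n.+1. *)
Definition peak_function (n : nat) (P : {fset nat}) : series K :=
  2%:R ^+ #|` P|.+1 *:
    \sum_(a : n.-bseq 'I_n.+1 |
        is_composition n (map val a) &&
        (P `<=` (let D := descents (map val a) in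
                 sym_diff D [fset x.+1 | x in D])))
      fundamental (map val a).

End PeakFunctions.

Section QFunctions.
Variable K : comNzRingType.

(* The polynomial \poly_(k < n.+1) x_i ^+ k is 1 / (1 - x_i z) modulo
   z ^ (n + 1), so this is the coefficient of z ^ n in the product of the
   (1 + x_i z) / (1 - x_i z) over i < N. *)
Definition q_partial (N n : nat) : series K :=
  (\prod_(i < N) ((1 + (series_var K i)%:P * 'X) *
                  \poly_(k < n.+1) series_var K i ^+ k))`_n.

(* The infinite product is taken coefficientwise: the coefficient of m no longer
   changes once all the variables of m are included, see q_partial_stable. *)
Definition q_function (n : nat) : series K :=
  fun m => q_partial (\max_(i <- (m : seq nat)) i.+1) n m.

Lemma series_var_mul_notin i (f : series K) (m : monomial) :
  i \notin m -> (series_var K i * f) m = 0.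
Proof.
move=> im; transitivity (series_mul (series_var K i) f m); first by [].
rewrite /series_mul big_seq big1 // => a; rewrite in_mdivisors => am.
rewrite /series_var; case: eqP => [a_i|_]; last by rewrite mul0r.
by case/negP: im; apply: (msubset_subset am); rewrite a_i mset11.
Qed.

Lemma q_partial_stable (N n : nat) (m : monomial) :
  (\max_(i <- (m : seq nat)) i.+1 <= N)%N -> q_partial N n m = q_function n m.
Proof.
rewrite /q_function; set N0 := \max_(i <- _) _ => le_N.
rewrite -(subnKC le_N); elim: (N - N0)%N => [|d IHd]; first by rewrite addn0.
rewrite -{}IHd addnS; set M := (N0 + d)%N.
have Mm : M \notin m.
  apply/negP => Mm; have : (M.+1 <= N0)%N by apply: (leq_bigmax_seq (F := S)).
  by rewrite ltnNge leq_addr.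
rewrite /q_partial big_ord_recr /=; set p := \prod_(i < M) _; set x := series_var K M.
have [g ->] : exists g : {poly series K},
    (1 + x%:P * 'X) * \poly_(k < n.+1) x ^+ k = 1 + x%:P * g.
  exists ('X * \poly_(k < n.+1) x ^+ k + \poly_(k < n) x ^+ k * 'X).
  have -> : \poly_(k < n.+1) x ^+ k = 1 + x%:P * (\poly_(k < n) x ^+ k * 'X).
    apply/polyP => k; rewrite coef_poly coefD coef1 coefCM coefMX coef_poly.
    case: k => [|k] /=; first by rewrite mulr0 addr0 expr0.
    by rewrite ltnS add0r exprS; case: ifP => _; rewrite ?mulr0.
  set u := \poly_(k < n) _; ring.
have -> : (p * (1 + x%:P * g))`_n = p`_n + x * (p * g)`_n.
  by rewrite mulrDr mulr1 coefD mulrCA coefCM.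
transitivity (p`_n m + (x * (p * g)`_n) m); first by [].
by rewrite series_var_mul_notin // addr0.
Qed.

End QFunctions.

Definition linear_span (K : comNzRingType) (V : lmodType K) (X : set V) : set V :=
  fun v => exists (s : {fset V}) (c : V -> K),
    (forall x, x \in s -> X x) /\ v = \sum_(x <- s) c x *: x.

Definition generated_subalgebra (K : comNzRingType) (A : algType K) (X : set A) :
    set A :=
  fun f => forall S : {pred A},
    GRing.subalg_closed S -> (forall x, X x -> x \in S) -> f \in S.

Definition PeakStar (K : comNzRingType) : set (series K) :=
  linear_span (fun f => f = 1 \/
    exists n P, [/\ (1 <= n)%N, is_peak_set n P & f = peak_function K n P]).

Definition Omega (K : comNzRingType) : set (series K) :=
  generated_subalgebra (fun f => exists2 n, (1 <= n)%N & f = q_function K n).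

(* For S a subring of the commutative ring A and M a subset of A: M is an
   S-submodule of A and is free as an S-module.  The second clause makes M the
   set of all S-linear combinations of B. *)
Definition is_basis_over (A : comNzRingType) (S M B : set A) : Prop :=
  (forall (s : {fset A}) (c : A -> A),
     (forall x, x \in s -> B x /\ S (c x)) ->
     \sum_(x <- s) c x * x = 0 -> forall x, x \in s -> c x = 0) /\
  (forall f : A, M f <->
     exists (s : {fset A}) (c : A -> A),
       (forall x, x \in s -> B x /\ S (c x)) /\ f = \sum_(x <- s) c x * x).

Definition free_module_over (A : comNzRingType) (S M : set A) : Prop :=
  exists B : set A, is_basis_over S M B.

(* Main.v *)
(* Peak^* consists of the quasisymmetric functions f of bounded degree such that
   f (..., -t, t, ...) = f (...) wherever the pair of variables is inserted: the
   coefficients of the K_P satisfy these linear relations, and the relations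
   determine f from its coefficients at the compositions whose descent set is a
   peak set, where the matrix of the K_P is triangular.  In this description
   Peak^* is clearly closed under products, contains Omega, and is stable under
   the operators D_k taking the coefficient of y^k in f (y, x_0, x_1, ...), which
   satisfy the Leibniz rule D_k (fg) = sum_(i + j = k) D_i f D_j g and preserve
   Omega as D_k q_n = 2 q_(n-k) for k > 0.  An element of Omega killed by all D_k
   with k > 0 is a constant.
   Choose for each d a K-basis B_d of the elements of degree <= d of Peak^*
   modulo the Omega-module V_d generated by those of degree < d.  The union of
   the B_d generates Peak^*.  If sum_x c_x x lies in V_d with x in B_d and c_x in
   Omega, applying D_k for k > 0 gives the same for the D_k c_x, of smaller
   degree; by induction these vanish, so the c_x are constants, hence 0. *)
Require Import Defs.
From HB Require Import structures.
From mathcomp Require Import all_boot all_algebra.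
From mathcomp Require Import zify finmap multiset.
From mathcomp Require Import boolp classical_sets functions.

Set Implicit Arguments.
Unset Strict Implicit.
Unset Printing Implicit Defensive.

Import GRing.Theory.
Local Open Scope ring_scope.

(** * Words as monomials, and the insertion of a variable *)

Fixpoint word_listing (i : nat) (w : seq nat) : seq nat :=
  if w is a :: w' then nseq a i ++ word_listing i.+1 w' else [::].

(* The word w stands for the monomial whose exponent of x_j is w_j. *)
Definition word_monomial (w : seq nat) : monomial := seq_mset (word_listing 0 w).

Lemma count_word_listing i w j :
  count_mem j (word_listing i w) = if (i <= j)%N then nth 0%N w (j - i) else 0%N.
Proof.
elim: w i => [|a w IHw] i /=; first by rewrite nth_nil if_same.
rewrite count_cat count_nseq IHw /=.
have [ltij|ltji|->] := ltngtP i j; rewrite ?mul0n ?mul1n ?addn0 ?subnn //=.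
by rewrite -[(j - i)%N]prednK ?subn_gt0 //= -subnS.
Qed.

Lemma word_monomialE w j : word_monomial w j = nth 0%N w j.
Proof. by rewrite mset_seqE count_word_listing leq0n subn0. Qed.

Lemma size_word_listing i w : size (word_listing i w) = sumn w.
Proof. by elim: w i => //= a w IHw i; rewrite size_cat size_nseq IHw. Qed.

Lemma size_word_monomial w : size (word_monomial w) = sumn w.
Proof. by rewrite (perm_size (perm_eq_seq_mset _)) size_word_listing. Qed.

Lemma word_listing_ge i w x : x \in word_listing i w -> (i <= x)%N.
Proof.
elim: w i => //= a w IHw i; rewrite mem_cat => /orP[|/IHw /ltnW//].
by rewrite mem_nseq => /andP[_ /eqP->].
Qed.

Lemma word_listing_sorted i w : sorted leq (word_listing i w).
Proof.
elim: w i => //= a w IHw i; rewrite sorted_pairwise; last exact: leq_trans.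
rewrite pairwise_cat -!sorted_pairwise ?IHw; try exact: leq_trans.
apply/and3P; split=> //.
- apply/allrelP => x y; rewrite mem_nseq => /andP[_ /eqP->].
  by move/word_listing_ge/ltnW.
- by case: a => //= a; elim: a => //= a IHa; rewrite leqnn.
Qed.

Lemma sort_word_monomial w : sort leq (word_monomial w) = word_listing 0 w.
Proof.
apply: (sorted_eq leq_trans anti_leq); last 1 first.
- by rewrite perm_sort perm_eq_seq_mset.
- exact: (sort_sorted leq_total).
- exact: word_listing_sorted.
Qed.

(** Padding with zero exponents makes the word long enough to be cut at any prescribed position. *)
Lemma word_monomial_exists i (m : monomial) :
  exists2 w, (i <= size w)%N & m = word_monomial w.
Proof.
exists (mkseq m (maxn i (\max_(j <- (m : seq nat)) j.+1))).
  by rewrite size_mkseq leq_maxl.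
apply/msetP => j; rewrite word_monomialE.
have [lt_j|le_j] := ltnP j (maxn i (\max_(j <- (m : seq nat)) j.+1)).
  by rewrite nth_mkseq.
rewrite nth_default ?size_mkseq //; apply/mset_eq0P/negP => jm.
have := leq_trans (leq_maxr _ _) le_j.
by rewrite leqNgt (leq_bigmax_seq (F := S)).
Qed.

Definition insert_var (i k : nat) (m : monomial) : monomial :=
  seq_mset (nseq k i ++ map (bump i) m).

Lemma insert_varE i k m j :
  insert_var i k m j = if j == i then k else m (unbump i j).
Proof.
rewrite mset_seqE count_cat count_nseq count_map /= eq_sym.
have [->|neq_ji] := eqVneq j i.
  rewrite mul1n (@eq_count _ _ pred0) ?count_pred0 ?addn0 // => x /=.
  by apply/negbTE; rewrite eq_sym neq_bump.
rewrite mul0n add0n -count_mem_mset; apply: eq_count => x /=.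
by apply/eqP/eqP => [<-|->]; rewrite ?bumpK // unbumpK // inE.
Qed.

Lemma insert_var_bump i k m x : insert_var i k m (bump i x) = m x.
Proof. by rewrite insert_varE eq_sym (negbTE (neq_bump _ _)) bumpK. Qed.

Lemma insert_var_at i k m : insert_var i k m i = k.
Proof. by rewrite insert_varE eqxx. Qed.

Lemma insert_var_word k s t :
  insert_var (size s) k (word_monomial (s ++ t)) = word_monomial (s ++ k :: t).
Proof.
apply/msetP => j; rewrite insert_varE !word_monomialE !nth_cat /unbump.
have [lt|gt|->] := ltngtP j (size s); rewrite ?subn0 ?lt ?subnn //=.
rewrite subn1 -ltnS prednK ?(leq_trans _ gt) // ltnS leqNgt gt /=.
by case: j gt => // j; rewrite ltnS => le; rewrite subSn.
Qed.

Lemma insert_var_exists i (m : monomial) :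
  exists k a, m = insert_var i k a.
Proof.
have [w lt_iw ->] := word_monomial_exists i.+1 m.
exists (nth 0%N w i), (word_monomial (take i w ++ drop i.+1 w)).
have := insert_var_word (nth 0%N w i) (take i w) (drop i.+1 w).
by rewrite size_takel 1?ltnW // -drop_nth // cat_take_drop => ->.
Qed.

Lemma insert_var_inj i k a l b :
  insert_var i k a = insert_var i l b -> k = l /\ a = b.
Proof.
move=> eq_ab; split; first by rewrite -(insert_var_at i k a) eq_ab insert_var_at.
by apply/msetP => x; rewrite -(insert_var_bump i k) eq_ab insert_var_bump.
Qed.

Lemma insert_var_sub i k a l b :
  (insert_var i k a `<=` insert_var i l b)%mset = (k <= l)%N && (a `<=` b)%mset.
Proof.
apply/msubsetP/andP => [le_ab|[le_kl /msubsetP le_ab] x].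
  split; first by have := le_ab i; rewrite !insert_var_at.
  by apply/msubsetP => x; have := le_ab (bump i x); rewrite !insert_var_bump.
by rewrite !insert_varE; case: ifP.
Qed.

Lemma insert_varB i k a l b :
  (insert_var i k a `\` insert_var i l b)%mset = insert_var i (k - l) (a `\` b)%mset.
Proof. by apply/msetP => x; rewrite msetE2 !insert_varE; case: ifP; rewrite ?msetE2. Qed.

Lemma size_insert_var i k m : size (insert_var i k m) = (k + size m)%N.
Proof.
by rewrite (perm_size (perm_eq_seq_mset _)) size_cat size_nseq size_map.
Qed.

Lemma insert_var_mset0 i k : (insert_var i k mset0 == mset0) = (k == 0)%N.
Proof.
apply/eqP/eqP => [/msetP/(_ i)|->]; first by rewrite insert_var_at mset0E.
by apply/msetP => x; rewrite insert_varE !mset0E if_same.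
Qed.

(** A divisor splits uniquely into an exponent of [x_i] and a divisor of [m]; this is what turns
    [hasse] of a product into a Leibniz sum. *)
Lemma mdivisors_insert_var i k m :
  perm_eq (mdivisors (insert_var i k m))
    [seq insert_var i j a | j <- iota 0 k.+1, a <- mdivisors m].
Proof.
apply: uniq_perm; first exact: fset_uniq.
  apply: allpairs_uniq; rewrite ?iota_uniq ?fset_uniq //.
  by move=> [j a] [l b] _ _ /insert_var_inj[/= -> ->].
move=> b; have [j [a ->]] := insert_var_exists i b.
rewrite in_mdivisors insert_var_sub; apply/andP/allpairsP => [[le_jk le_am]|].
  by exists (j, a); split=> //; rewrite ?mem_iota ?in_mdivisors.
move=> [[l c] [lk cm /insert_var_inj[-> ->]]].
by rewrite mem_iota in_mdivisors in lk cm.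
Qed.

(** * Coefficient extraction operators and their Leibniz rule *)

Section Insertion.
Variable K : comNzRingType.
Implicit Types f g : series K.

(* The coefficient of t ^ k in f (x_0, ..., x_(i-1), t, x_i, x_(i+1), ...). *)
Definition hasse (i k : nat) (f : series K) : series K :=
  fun m => f (insert_var i k m).

Lemma hasse_word k f s t :
  hasse (size s) k f (word_monomial (s ++ t)) = f (word_monomial (s ++ k :: t)).
Proof. by rewrite /hasse insert_var_word. Qed.

Lemma hasse_is_linear i k : linear (hasse i k).
Proof. by []. Qed.
HB.instance Definition _ i k :=
  GRing.isLinear.Build K (series K) (series K) _ (hasse i k) (hasse_is_linear i k).

Lemma series_sumE (I : Type) (r : seq I) (P : pred I) (F : I -> series K) m :
  (\sum_(i <- r | P i) F i) m = \sum_(i <- r | P i) F i m.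
Proof. by elim/big_rec2: _ => // i x y _ <-. Qed.

Lemma hasseM i k f g :
  hasse i k (f * g) = \sum_(j < k.+1) hasse i j f * hasse i (k - j) g.
Proof.
apply/funext => m.
transitivity (\sum_(a <- mdivisors (insert_var i k m))
  f a * g (insert_var i k m `\` a)%mset) => //.
rewrite series_sumE (perm_big _ (mdivisors_insert_var i k m)) big_allpairs_dep /=.
rewrite -[RHS](big_mkord xpredT
  (fun j => (hasse i j f * hasse i (k - j) g : series K) m)).
rewrite /index_iota subn0; apply: eq_bigr => j _.
transitivity (\sum_(a <- mdivisors m) hasse i j f a * hasse i (k - j) g (m `\` a)%mset) => //.
by apply: eq_bigr => a _; rewrite insert_varB.
Qed.

Lemma hasse1 i k : hasse i k 1 = (k == 0)%N%:R.
Proof.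
apply/funext => m; transitivity ((insert_var i k m == mset0)%:R : K) => //.
have [->|neq_k0] := eqVneq k 0%N.
  have -> : (insert_var i 0 m == mset0) = (m == mset0); last by [].
  apply/eqP/eqP => [eq_m0|->].
    by apply/msetP => x; rewrite -(insert_var_bump i 0) eq_m0 !mset0E.
  by apply/eqP; rewrite insert_var_mset0.
by case: eqP => // /msetP/(_ i) /eqP; rewrite insert_var_at mset0E (negbTE neq_k0).
Qed.

End Insertion.

(** Substituting the inner variable for the outer one collapses a bivariate polynomial onto its
    antidiagonals. *)
Lemma coef_horner_diagonal (R : comNzRingType) (p : {poly {poly R}}) n :
  (p.['X])`_n = \sum_(j < n.+1) p`_j`_(n - j).
Proof.
rewrite (@horner_coef_wide _ (maxn (size p) n.+1)) ?leq_maxl // coef_sum.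
rewrite (big_ord_widen (maxn (size p) n.+1) (fun j => p`_j`_(n - j))) ?leq_maxr //.
rewrite [RHS]big_mkcond /=; apply: eq_bigr => j _.
by rewrite coefMXn ltnS; case: leqP.
Qed.

(** * Cancelling series and degree bounds *)

Section Cancellation.
Variable K : comNzRingType.
Implicit Types f g : series K.

(* The coefficient of t ^ n in f (x_0, ..., x_(i-1), -t, t, x_i, ...). *)
Definition insert_pair (i n : nat) (f : series K) : series K :=
  \sum_(a < n.+1) (-1) ^+ a *: hasse i (n - a) (hasse i a f).

(** Substituting [-t, t] is a ring morphism: it is a two-variable expansion, multiplicative by
    [hasseM], followed by setting the two variables equal. *)
Lemma insert_pairM i n f g :
  insert_pair i n (f * g) =
  \sum_(s < n.+1) insert_pair i s f * insert_pair i (n - s) g.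
Proof.
(* Truncation at [n] suffices for the coefficient of [t ^ n]; the sign of [-t] sits in the outer
   coefficients. *)
pose U h : {poly {poly series K}} := \poly_(j < n.+1) \poly_(l < n.+1)
  ((-1) ^+ j *: hasse i l (hasse i j h)).
have coefU h j l : (j <= n)%N -> (l <= n)%N ->
    (U h)`_j`_l = (-1) ^+ j *: hasse i l (hasse i j h).
  by move=> lejn leln; rewrite !coef_poly ltnS lejn coef_poly ltnS leln.
have diagU h s : (s <= n)%N -> ((U h).['X])`_s = insert_pair i s h.
  move=> le_sn; rewrite coef_horner_diagonal; apply: eq_bigr => j _.
  by rewrite coefU //; have := ltn_ord j; lia.
transitivity (((U f * U g).['X])`_n).
  rewrite coef_horner_diagonal; apply: eq_bigr => a _.
  rewrite coefM coef_sum hasseM raddf_sum scaler_sumr; apply: eq_bigr => j _.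
  rewrite coefM /= hasseM scaler_sumr; apply: eq_bigr => l _.
  have := ltn_ord a; have := ltn_ord j; have := ltn_ord l => ltl ltj lta.
  rewrite !coefU; try lia.
  by rewrite -scalerAl -scalerAr scalerA -exprD subnKC.
rewrite hornerM coefM; apply: eq_bigr => s _.
by rewrite !diagU // ?leq_subr // -ltnS ltn_ord.
Qed.

(** The first clause is quasisymmetry: zero exponents may be inserted anywhere. The second says that
    an inserted pair [-t, t] contributes nothing in positive degree in [t]. *)
Definition cancelling f : Prop :=
  (forall i, hasse i 0 f = f) /\ (forall i n, (0 < n)%N -> insert_pair i n f = 0).

Lemma cancelling_wordP f :
  cancelling f <->
  (forall s t, f (word_monomial (s ++ 0%N :: t)) = f (word_monomial (s ++ t))) /\
  (forall s t n, (0 < n)%N ->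
    \sum_(a < n.+1) (-1) ^+ a * f (word_monomial (s ++ (a : nat) :: (n - a)%N :: t)) = 0).
Proof.
have pairE s t n : insert_pair (size s) n f (word_monomial (s ++ t)) =
    \sum_(a < n.+1) (-1) ^+ a * f (word_monomial (s ++ (a : nat) :: (n - a)%N :: t)).
  rewrite /insert_pair series_sumE; apply: eq_bigr => a _.
  transitivity ((-1) ^+ a * hasse (size s) (n - a) (hasse (size s) a f)
    (word_monomial (s ++ t))) => //.
  by rewrite !hasse_word.
split=> [[f0 fn]|[f0 fn]]; split.
- by move=> s t; rewrite -hasse_word f0.
- by move=> s t n n_gt0; rewrite -pairE fn.
- move=> i; apply/funext => m; have [w lt_iw ->] := word_monomial_exists i m.
  rewrite -(cat_take_drop i w); move: (take i w) (drop i w) (size_takel lt_iw).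
  by move=> s t <-; rewrite hasse_word f0.
- move=> i n n_gt0; apply/funext => m.
  have [w lt_iw ->] := word_monomial_exists i m.
  rewrite -(cat_take_drop i w); move: (take i w) (drop i w) (size_takel lt_iw).
  by move=> s t <-; rewrite pairE fn.
Qed.

Lemma cancelling1 : cancelling 1.
Proof.
split=> [i|i n n_gt0]; first by rewrite hasse1.
rewrite /insert_pair big1 // => a _; rewrite hasse1.
have [a0|] := eqVneq (nat_of_ord a) 0%N; last by rewrite mulr0n !linear0.
by rewrite hasse1 a0 subn0 (gtn_eqF n_gt0) scaler0.
Qed.

Lemma cancellingD c f g : cancelling f -> cancelling g -> cancelling (c *: f + g).
Proof.
move=> [f0 fn] [g0 gn]; split=> [i|i n n_gt0]; first by rewrite hasse_is_linear f0 g0.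
transitivity (c *: insert_pair i n f + insert_pair i n g); last first.
  by rewrite fn // gn // scaler0 addr0.
rewrite /insert_pair scaler_sumr -big_split; apply: eq_bigr => a _ /=.
by rewrite !hasse_is_linear scalerDr !scalerA mulrC.
Qed.

Lemma cancellingM f g : cancelling f -> cancelling g -> cancelling (f * g).
Proof.
move=> [f0 fn] [g0 gn]; split=> [i|i n n_gt0].
  by rewrite hasseM big_ord1 f0 g0.
rewrite insert_pairM big1 // => s _.
have [->|s_gt0] := posnP s; first by rewrite subn0 gn // mulr0.
by rewrite fn // mul0r.
Qed.

(** Prefixing the letter [k] turns the relations with prefix [s] into relations with prefix
    [k :: s]. *)
Lemma cancelling_hasse k f : cancelling f -> cancelling (hasse 0 k f).
Proof.
move=> /cancelling_wordP[f0 fn]; apply/cancelling_wordP; split=> [s t|s t n n_gt0].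
  by rewrite !(hasse_word k f [::]) -cat_cons f0.
rewrite -[RHS](fn (k :: s) t n n_gt0); apply: eq_bigr => a _.
by rewrite (hasse_word k f [::]).
Qed.

(** The bound is strict, so that only the zero series has bound 0, where the inductions on degree
    start. *)
Definition degree_lt (d : nat) f : Prop := forall m : monomial, (d <= size m)%N -> f m = 0.

Lemma degree_ltW d e f : (d <= e)%N -> degree_lt d f -> degree_lt e f.
Proof. by move=> le_de fd m le_em; apply: fd; apply: leq_trans le_em. Qed.

Lemma degree_lt1 : degree_lt 1 1.
Proof.
move=> m m_gt0; transitivity ((m == mset0)%:R : K) => //.
by case: eqP m_gt0 => // ->; rewrite enum_mset0.
Qed.

Lemma degree_ltD d c f g : degree_lt d f -> degree_lt d g -> degree_lt d (c *: f + g).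
Proof.
move=> fd gd m dm; transitivity (c * f m + g m) => //.
by rewrite fd // gd // mulr0 addr0.
Qed.

Lemma size_msetB (a m : monomial) :
  (a `<=` m)%mset -> size m = (size a + size (m `\` a)%mset)%N.
Proof.
move=> /msubsetP le_am; rewrite -size_cat; apply: perm_size.
apply/allP => x _ /=; rewrite count_cat !count_mem_mset msetE2.
by rewrite subnKC.
Qed.

Lemma degree_ltM d e f g :
  degree_lt d f -> degree_lt e g -> degree_lt (d + e) (f * g).
Proof.
move=> fd ge m lem.
transitivity (\sum_(a <- mdivisors m) f a * g (m `\` a)%mset) => //.
rewrite big_seq big1 // => a; rewrite in_mdivisors => /size_msetB sz_m.
have [/fd->|lt_a] := leqP d (size (a : monomial)); first by rewrite mul0r.
by rewrite ge ?mulr0 //; move: lem lt_a; rewrite sz_m; lia.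
Qed.

Lemma degree_lt_hasse i d k f : degree_lt d f -> degree_lt (d - k) (hasse i k f).
Proof. by move=> fd m lem; apply: fd; rewrite size_insert_var; lia. Qed.

(* A shift-invariant series is determined by its coefficients at the monomials
   that involve x_0, and at 1. *)
Lemma hasse_eq0_const f : hasse 0 0 f = f ->
  (forall k, (0 < k)%N -> hasse 0 k f = 0) -> f = f mset0 *: 1.
Proof.
move=> f0 fk; apply/funext => m.
transitivity (f mset0 * (m == mset0)%:R) => //.
have [->|] := eqVneq m mset0; first by rewrite mulr1.
have [w _ ->] := word_monomial_exists 0 m; rewrite mulr0.
elim: w => [|k w IHw].
  case/eqP; apply/msetP => x.
  by rewrite word_monomialE nth_nil mset0E.
have -> : word_monomial (k :: w) = insert_var 0 k (word_monomial w).
  by have := insert_var_word k [::] w.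
have [->|k_gt0] := posnP k; last first.
  by have /(congr1 (@^~ (word_monomial w))) := fk k k_gt0.
move=> neq0; transitivity (hasse 0 0 f (word_monomial w)); first by [].
rewrite f0; apply: IHw; apply: contraNneq neq0 => ->.
by rewrite insert_var_mset0.
Qed.

End Cancellation.

(** * Partial sums of words and descent sets of compositions *)

Section PartialSums.
Local Open Scope fset_scope.
Local Open Scope nat_scope.
Implicit Types (s t w a : seq nat) (p x n : nat).

Definition psums p w : seq nat := p :: scanl addn p w.

Lemma mem_psums_cons x p k w : (x \in psums p (k :: w)) = (x == p) || (x \in psums (p + k) w).
Proof. by []. Qed.

Lemma psums_start p w : p \in psums p w.
Proof. exact: mem_head. Qed.

Lemma mem_psums_cat x p s t :
  (x \in psums p (s ++ t)) = (x \in psums p s) || (x \in psums (p + sumn s) t).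
Proof.
elim: s p => [|k s IHs] p.
  by rewrite addn0 /psums !inE; case: eqP.
by rewrite cat_cons !mem_psums_cons IHs /= addnA orbA.
Qed.

Lemma psums_bounds x p w : x \in psums p w -> p <= x <= p + sumn w.
Proof.
elim: w p => [|k w IHw] p; first by rewrite inE => /eqP->; rewrite addn0 leqnn.
by rewrite mem_psums_cons => /orP[/eqP->|/IHw] /=; lia.
Qed.

Lemma psums_end p w : p + sumn w \in psums p w.
Proof.
elim: w p => [|k w IHw] p; first by rewrite addn0 inE.
by rewrite mem_psums_cons /= addnA IHw orbT.
Qed.

Lemma mem_psumsD x p q w : (p + x \in psums (p + q) w) = (x \in psums q w).
Proof.
elim: w q => [|k w IHw] q; first by rewrite !inE eqn_add2l.
by rewrite !mem_psums_cons eqn_add2l -addnA IHw.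
Qed.

Lemma mem_psumsP x w :
  reflect (exists2 k, k <= size w & x = sumn (take k w)) (x \in psums 0 w).
Proof.
apply: (iffP idP) => [|[k le_kw ->]]; last first.
  have := mem_psums_cat (sumn (take k w)) 0 (take k w) (drop k w).
  by rewrite cat_take_drop => ->; apply/orP; left; apply: (psums_end 0).
elim: w x => [|a w IHw] x.
  by rewrite inE => /eqP->; exists 0.
rewrite mem_psums_cons => /orP[/eqP->|]; first by exists 0.
move=> xw; have := psums_bounds xw => /andP[le_ax _].
have := mem_psumsD (x - a) a 0 w; rewrite addn0 subnKC // -[a in psums a]add0n xw.
by move/esym/IHw => [k le_k eq_x]; exists k.+1 => //=; rewrite -eq_x subnKC.
Qed.

(** This is the descent set of the composition obtained from [w] by erasing its zeros. *)
Definition inner_psums w : {fset nat} := [fset x in psums 0 w | 0 < x < sumn w].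

Lemma in_inner_psums x w :
  (x \in inner_psums w) = (x \in psums 0 w) && (0 < x < sumn w).
Proof. by rewrite !inE. Qed.

Lemma mem_psums_inner x w :
  (x \in psums 0 w) = [|| x == 0, x == sumn w | x \in inner_psums w].
Proof.
rewrite in_inner_psums; apply/idP/idP => [xw|/or3P[/eqP->|/eqP->|/andP[]//]].
- by have := psums_bounds xw; rewrite xw /= add0n; case: ltngtP => //; lia.
- exact: psums_start.
- exact: (psums_end 0).
Qed.

(** Each nonzero letter creates one new partial sum and a zero letter repeats one; the values 0 and
    [sumn w] account for the shift. *)
Lemma card_inner_psums w :
  0 < sumn w -> (#|` inner_psums w|).+1 = count (predC1 0) w.
Proof.
move=> w_gt0.
have szE p : size (undup (psums p w)) = (count (predC1 0) w).+1.
  elim: w p {w_gt0} => [|k w IHw] p //.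
  have -> : psums p (k :: w) = p :: psums (p + k) w by [].
  have undup_cons (x : nat) s : undup (x :: s) = if x \in s then undup s else x :: undup s.
    by [].
  rewrite {}undup_cons /=.
  have [->|k_neq0] := eqVneq k 0; first by rewrite addn0 psums_start IHw.
  case: ifP => [/psums_bounds|_]; first by move/eqP: k_neq0; lia.
  by rewrite /= IHw.
apply: succn_inj; rewrite -(szE 0).
have -> : #|` inner_psums w|.+2 = #|` [fset x in psums 0 w]|.
  have -> : [fset x in psums 0 w] = 0 |` (sumn w |` inner_psums w).
    by apply/fsetP => x; rewrite in_fset1U in_fset1U in_fset mem_psums_inner.
  rewrite !cardfsU1 !in_fset1U !in_inner_psums !ltnn !andbF /= orbF.
  by rewrite eq_sym -lt0n w_gt0.
by rewrite card_fseq.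
Qed.

Lemma sumn_gt0 a : 0 \notin a -> (0 < sumn a) = (a != [::]).
Proof. by case: a => //= k a; rewrite inE negb_or; lia. Qed.

Lemma descents_inner a : 0 \notin a -> descents a = inner_psums a.
Proof.
move=> a0; apply/fsetP => x; rewrite in_inner_psums.
have split_sum k : sumn a = sumn (take k a) + sumn (drop k a).
  by rewrite -sumn_cat cat_take_drop.
have t0 k : 0 \notin take k a by apply: contra a0; apply: mem_take.
have d0 k : 0 \notin drop k a by apply: contra a0; apply: mem_drop.
(* As no letter is 0, a prefix is nonempty and proper exactly when its sum lies strictly between 0
   and the total. *)
have bounds (k : nat) : k <= size a ->
    (k \in iota 1 (size a).-1) = (0 < sumn (take k a) < sumn a).
  have -> : (sumn (take k a) < sumn a) = (0 < sumn (drop k a)).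
    by rewrite (split_sum k) -[X in X < _]addn0 ltn_add2l.
  move=> le_ka; rewrite !sumn_gt0 // -!size_eq0 size_takel // size_drop mem_iota.
  rewrite -!lt0n subn_gt0 add1n ltnS.
  by case: (size a) le_ka => [|l]; rewrite ?ltnS // leqn0 => /eqP->.
apply/imfsetP/andP => [[k /= k_iota ->]|[/mem_psumsP[k le_ka ->]]].
  have le_ka : k <= size a by move: k_iota; rewrite mem_iota; lia.
  by rewrite -bounds //; split=> //; apply/mem_psumsP; exists k.
by rewrite -bounds // => k_iota; exists k.
Qed.

Lemma psums_sorted p a : 0 \notin a -> sorted ltn (psums p a).
Proof.
rewrite /psums /=; elim: a p => //= k a IHa p; rewrite inE negb_or => /andP[k0 a0].
by rewrite IHa // andbT -[X in X < _]addn0 ltn_add2l lt0n eq_sym.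
Qed.

Lemma psums_inj p a b : psums p a = psums p b -> a = b.
Proof.
elim: a p b => [|k a IHa] p [|l b] //= [/addnI-> ] eq_ab.
by rewrite (IHa (p + l) b) // /psums eq_ab.
Qed.

(** Without zero letters the partial sums increase strictly, so their set determines their list,
    hence the word. *)
Lemma composition_descents_inj n a b :
  is_composition n a -> is_composition n b -> descents a = descents b -> a = b.
Proof.
move=> /andP[a0 /eqP an] /andP[b0 /eqP bn] eq_ab; apply: (@psums_inj 0).
apply: (irr_sorted_eq ltn_trans ltnn); rewrite ?psums_sorted // => x.
by rewrite !mem_psums_inner -!descents_inner // an bn eq_ab.
Qed.

Lemma composition_descents_exists n (A : {fset nat}) :
  0 < n -> (forall x, x \in A -> 0 < x < n) ->
  exists2 a, is_composition n a & descents a = A.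
Proof.
move=> n_gt0 An.
(* The letters are the successive differences of 0, the sorted elements of [A], and [n]. *)
have diffs l p : path ltn p l -> exists2 a, 0 \notin a & psums p a = p :: l.
  elim: l p => [|q l IHl] p /=; first by exists [::].
  case/andP=> lt_pq /IHl[a a0 def_l]; exists (q - p :: a).
    by rewrite inE negb_or a0 andbT; lia.
  by rewrite /psums /= subnKC ?(ltnW lt_pq) // -/(psums q a) def_l.
have sort_A : path ltn 0 (rcons (sort leq A) n).
  have: sorted ltn (sort leq A).
    rewrite ltn_sorted_uniq_leq sort_uniq fset_uniq.
    exact: (sort_sorted leq_total).
  have: all (fun x => 0 < x < n) (sort leq A).
    by apply/allP => x; rewrite mem_sort => /An.
  rewrite rcons_path; case: (sort leq A) => [|y l]; first by rewrite /= n_gt0.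
  move=> /allP lt_n /= ->; have /andP[-> _] := lt_n y (mem_head _ _).
  by have /andP[_ ->] := lt_n _ (mem_last y l).
have [a a0 def_a] := diffs _ _ sort_A.
have an : sumn a = n.
  have := psums_end 0 a; have := psums_bounds (_ : n \in psums 0 a).
  rewrite def_a !inE mem_rcons !inE eqxx orbT => /(_ isT)/andP[_ le_na].
  rewrite mem_rcons inE mem_sort => /or3P[/eqP|/eqP|/An] //; move: le_na; lia.
exists a; first by rewrite /is_composition a0 an eqxx.
rewrite descents_inner //; apply/fsetP => x; rewrite in_inner_psums def_a an.
rewrite !inE mem_rcons !inE mem_sort.
by apply/andP/idP => [[/or3P[/eqP->|/eqP->|//]]|xA]; rewrite ?ltnn ?andbF ?xA ?orbT ?An.
Qed.

(** The listing consists of constant blocks whose lengths are the letters of [w], so it increases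
    exactly at block ends. *)
Lemma word_listing_ascent i w k : 0 < k < sumn w ->
  (nth 0 (word_listing i w) k.-1 < nth 0 (word_listing i w) k) = (k \in psums 0 w).
Proof.
elim: w i k => [|a w IHw] i k /=; first by rewrite ltn0 andbF.
case/andP=> k_gt0 lt_k; rewrite mem_psums_cons (gtn_eqF k_gt0) /=.
rewrite !nth_cat size_nseq !nth_nseq.
have [lt_ka|lt_ak|eq_ka] := ltngtP k a.
- have -> : k.-1 < a by lia.
  rewrite ltnn; apply/esym/negP => /psums_bounds; lia.
- have -> : (k.-1 < a) = false by lia.
  rewrite -{3}(subnKC (ltnW lt_ak)) -[X in psums X]addn0 add0n mem_psumsD -(IHw i.+1); last lia.
  by have -> : k.-1 - a = (k - a).-1 by lia.
rewrite {}eq_ka in k_gt0 lt_k *.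
have -> : a.-1 < a by lia.
rewrite subnn psums_start; apply: (@word_listing_ge i.+1 w).
by apply: mem_nth; rewrite size_word_listing; lia.
Qed.

End PartialSums.

(** * Counting the subsets of [D] that flip at every element of [P] *)

Section PeakCount.
Local Open Scope fset_scope.
Local Open Scope nat_scope.
Implicit Types (A D P : {fset nat}) (x y n : nat).

(** For [x > 0] this is membership in the symmetric difference of [A] and [A + 1], see
    [in_sym_diff_succ]. *)
Definition flips A x : bool := (x \in A) (+) (x.-1 \in A).

Lemma in_sym_diff_succ A x : 0 < x ->
  (x \in sym_diff A [fset y.+1 | y in A]) = flips A x.
Proof.
case: x => // x _; rewrite /sym_diff /flips /= !inE.
have -> : (x.+1 \in [fset y.+1 | y in A]) = (x \in A).
  by apply/imfsetP/idP => [[y /= yA [->]]|xA] //; exists x.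
by case: (x.+1 \in A); case: (x \in A).
Qed.

(** Up to the power of 2, this is the coefficient of [K_P] at a word with inner partial sums [D],
    see [sum_fundamental_word]. *)
Definition flip_count D P : nat :=
  \sum_(A <- fpowerset D | all (flips A) P) 1.

Definition toggle y A : {fset nat} := if y \in A then A `\ y else y |` A.

Lemma in_toggle y A x : (x \in toggle y A) = (x \in A) (+) (x == y).
Proof.
rewrite /toggle; case: ifP => yA; rewrite !inE.
  by case: eqP => [->|_]; rewrite ?yA //= addbF.
by case: eqP => [->|_]; rewrite ?yA //= addbF.
Qed.

Lemma toggleK y : involutive (toggle y).
Proof. by move=> A; apply/fsetP => x; rewrite !in_toggle -addbA addbb addbF. Qed.

Lemma toggle_fpowerset y D : y \in D ->
  perm_eq [seq toggle y A | A <- fpowerset D] (fpowerset D).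
Proof.
move=> yD; have sub A : A `<=` D -> toggle y A `<=` D.
  move=> /fsubsetP AD; apply/fsubsetP => x; rewrite in_toggle.
  by case: eqP => [->|_] //; rewrite addbF; apply: AD.
apply: uniq_perm; rewrite ?fset_uniq //.
  by rewrite map_inj_uniq ?fset_uniq //; apply: (can_inj (toggleK y)).
move=> A; apply/mapP/idP => [[B + ->]|]; rewrite !fpowersetE; first exact: sub.
by move=> AD; exists (toggle y A); rewrite ?toggleK // fpowersetE sub.
Qed.

Lemma flips_toggle y A x : (x == y) != (x.-1 == y) ->
  flips (toggle y A) x = ~~ flips A x.
Proof.
rewrite /flips !in_toggle.
by case: (x \in A); case: (x.-1 \in A); case: (x == y); case: (x.-1 == y).
Qed.

Lemma flips_toggle_id y A x : x != y -> x.-1 != y ->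
  flips (toggle y A) x = flips A x.
Proof. by rewrite /flips !in_toggle => /negbTE-> /negbTE->; rewrite !addbF. Qed.

Lemma is_peak_setS n P P' : P' `<=` P -> is_peak_set n P -> is_peak_set n P'.
Proof.
move=> /fsubsetP sub peak x /sub/peak[bx xP]; split=> //.
by apply: contra xP; apply: sub.
Qed.

(* Toggling an element of D that lies in {x, x - 1} exchanges the sets that
   flip at x and those that do not, without affecting the other peaks: these
   are at distance at least 2 from x. *)
Lemma flip_countE n D P : is_peak_set n P ->
  2 ^ #|` P| * flip_count D P =
  all (fun x => (x \in D) || (x.-1 \in D)) P * 2 ^ #|` D|.
Proof.
elim/finSet_rect: P => P IHP peakP.
have [->|[x xP]] := fset_0Vmem P.
  have all0 (q : pred nat) : all q (fset0 : {fset nat}) by apply/allP => x; rewrite inE.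
  rewrite cardfs0 all0 !mul1n /flip_count (eq_bigl xpredT) => [|A]; last exact: all0.
  by rewrite sum1_size card_fpowerset.
have P'P : P `\ x `<` P by rewrite fproperD1.
have peakP' := is_peak_setS (fproper_sub P'P) peakP.
have {}IHP := IHP _ P'P peakP'.
have allP (q : pred nat) : all q P = q x && all q (P `\ x).
  apply/allP/andP => [qP|[qx /allP qP] y yP].
    by split; [apply: qP | apply/allP => y; rewrite !inE => /andP[_]; apply: qP].
  by have [->//|neq] := eqVneq y x; apply: qP; rewrite !inE neq.
have [[x_ge2 _] _] := (peakP x xP, tt).
rewrite (cardfsD1 x) xP add1n expnS allP.
have [xD|xD] := boolP ((x \in D) || (x.-1 \in D)); last first.
  rewrite mul0n /flip_count big1_seq ?muln0 // => A /andP[]; rewrite allP.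
  case/andP => + _; rewrite /flips fpowersetE => + /fsubsetP AD.
  by rewrite negb_or in xD; case/andP: xD => /(contra (AD _))/negbTE->
    /(contra (AD _))/negbTE->.
have [y yD yx] : exists2 y, y \in D & (y == x) (+) (y == x.-1).
  by case/orP: xD => ?; [exists x | exists x.-1]; rewrite // eqxx; lia.
rewrite /= -IHP [2 * _]mulnC -mulnA; congr (_ * _).
rewrite /flip_count [RHS](bigID (flips^~ x)) /=.
rewrite [X in _ = _ + X](_ : _ = flip_count D P).
  by rewrite mul2n -addnn; congr (_ + _); apply: eq_bigl => A; rewrite allP andbC.
rewrite -(perm_big _ (toggle_fpowerset yD)) big_map; apply: eq_bigl => A.
rewrite allP andbC flips_toggle; last by case: eqP yx; case: eqP; lia.
rewrite negbK; congr (_ && _); apply: eq_in_all => z.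
rewrite !inE => /andP[zx zP]; have [/andP[z_ge2 _] zP'] := peakP z zP.
have [_ xP'] := peakP x xP.
have zx1 : z != x.-1 by apply: contraNneq xP' => <-.
have z1x : z.-1 != x by apply: contraNneq zP' => ->.
by apply: flips_toggle_id; case/addbP: yx; lia.
Qed.

End PeakCount.

(** * Coefficients of the peak functions and their cancellation *)

Section PeakCoefficients.
Variable K : comNzRingType.
Implicit Types (s t w : seq nat) (P : {fset nat}).

(** The sorted listing of [w] increases exactly at the partial sums, so admissibility becomes an
    inclusion of sets. *)
Lemma fundamental_word (a : seq nat) w : 0%N \notin a ->
  fundamental K a (word_monomial w) =
  ((sumn w == sumn a) && (descents a `<=` inner_psums w)%fset)%:R.
Proof.
move=> a0; rewrite /fundamental sort_word_monomial size_word_listing.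
case: eqP => //= sum_wa; congr (nat_of_bool _)%:R.
apply/allP/fsubsetP => sub x xa; have := sub x xa;
  move: (xa); rewrite descents_inner // in_inner_psums -sum_wa => /andP[_ lt_x].
- by rewrite word_listing_ascent // in_inner_psums lt_x andbT.
- by rewrite word_listing_ascent // in_inner_psums lt_x andbT.
Qed.

(** The condition on [D] left by [flip_countE]. The extra partial sums 0 and [sumn w] are neither
    [x] nor [x - 1] for a peak [x]. *)
Definition covered w x : bool := (x \in psums 0 w) || (x.-1 \in psums 0 w).

(** Taking descents is a bijection from the compositions of [n] with descents among the inner
    partial sums of [w] onto the subsets of that set, so the fundamentals that contribute are
    counted by [flip_count]. *)
Lemma sum_fundamental_word n P w :
  (0 < n)%N -> is_peak_set n P -> sumn w = n ->
  (\sum_(a : n.-bseq 'I_n.+1 |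
        is_composition n (map val a) &&
        (P `<=` (let D := descents (map val a) in
                 sym_diff D [fset x.+1 | x in D]))%fset)
      fundamental K (map val a)) (word_monomial w) =
  (flip_count (inner_psums w) P)%:R.
Proof.
move=> n_gt0 peakP wn; rewrite series_sumE.
pose comp (a : n.-bseq 'I_n.+1) := is_composition n (map val a).
pose desc (a : n.-bseq 'I_n.+1) := descents (map val a).
have flipE (D : {fset nat}) :
    (P `<=` sym_diff D [fset x.+1 | x in D])%fset = all (flips D) P.
  apply/fsubsetP/allP => sub x xP; have := sub x xP;
  by rewrite in_sym_diff_succ //; have [/andP[]] := peakP x xP; case: (x).
transitivity ((\sum_(a | (comp a && (desc a `<=` inner_psums w)%fset) &&
    all (flips (desc a)) P) 1)%N%:R : K).
  rewrite natr_sum big_mkcondr [RHS]big_mkcondr /= [RHS]big_mkcondr /=.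
  apply: eq_bigr => a comp_a; rewrite flipE -/(desc a).
  have /andP[a0 /eqP an] := comp_a.
  rewrite fundamental_word // wn an eqxx /= -/(desc a).
  by case: ifP; case: ifP.
congr (_%:R); rewrite /flip_count.
rewrite -(@perm_big _ _ _ _ [seq desc a | a <- index_enum _ &
  comp a && (desc a `<=` inner_psums w)%fset]) /=.
  by rewrite big_map big_filter_cond.
apply: uniq_perm; rewrite ?fset_uniq //.
  rewrite map_inj_in_uniq ?filter_uniq ?index_enum_uniq // => a b.
  rewrite !mem_filter => /andP[/andP[ca _] _] /andP[/andP[cb _] _].
  move/(composition_descents_inj ca cb)/(inj_map val_inj) => eq_ab.
  exact: val_inj.
move=> A; rewrite fpowersetE; apply/mapP/idP => [[a]|sub].
  by rewrite mem_filter => /andP[/andP[_ ?] _] ->.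
have [x xA|a comp_a def_A] := @composition_descents_exists n A n_gt0.
  by have := fsubsetP sub x xA; rewrite in_inner_psums wn => /andP[].
have [a0 /eqP an] := andP comp_a.
(* The composition has to fit the index type: at most [n] letters, each at most [n]. *)
have le_size : (size a <= n)%N.
  rewrite -an; elim: a {comp_a def_A an} a0 => //= k a IHa.
  by rewrite inE negb_or => /andP[k0 /IHa]; lia.
have le_part x : x \in a -> (x < n.+1)%N.
  by move=> xa; rewrite ltnS -an (perm_sumn (perm_to_rem xa)) /= leq_addr.
have sz : (size (map (@inord n) a) <= n)%N by rewrite size_map.
have valE : map val (Bseq sz) = a.
  rewrite /= -map_comp -[RHS]map_id; apply/eq_in_map => x xa /=.
  by rewrite inordK ?le_part.
exists (Bseq sz); last by rewrite /desc valE.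
by rewrite mem_filter mem_index_enum andbT /comp /desc valE comp_a def_A.
Qed.

(** By [flip_countE] the factor [2 ^ |P|] completes the count to [2 ^ |D|], and the remaining 2
    raises [|D|] to the number of nonzero letters. *)
Lemma peak_function_word n P w : (0 < n)%N -> is_peak_set n P ->
  peak_function K n P (word_monomial w) =
  ((sumn w == n) && all (covered w) P)%:R * 2%:R ^+ count (predC1 0%N) w.
Proof.
move=> n_gt0 peakP; rewrite /peak_function.
transitivity (2%:R ^+ #|` P|.+1 * (\sum_(a : n.-bseq 'I_n.+1 |
        is_composition n (map val a) &&
        (P `<=` (let D := descents (map val a) in
                 sym_diff D [fset x.+1 | x in D]))%fset)
      fundamental K (map val a)) (word_monomial w)) => //.
have [wn|wn] := eqVneq (sumn w) n; last first.
  rewrite mul0r series_sumE big1 ?mulr0 // => a /andP[/andP[a0 /eqP an] _].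
  by rewrite fundamental_word // an (negbTE wn).
rewrite sum_fundamental_word // -natrX -natrM expnS -mulnA.
rewrite (flip_countE (inner_psums w) peakP) mulnCA -expnS card_inner_psums ?wn //.
rewrite natrM natrX; congr ((nat_of_bool _)%:R * _); apply: eq_in_all => x xP.
have [/andP[x_ge2 x_lt] _] := peakP x xP.
rewrite /covered !mem_psums_inner wn.
have -> : (x == 0%N) = false by apply/negP => /eqP; lia.
have -> : (x == n) = false by apply/negP => /eqP; lia.
have -> : (x.-1 == 0%N) = false by apply/negP => /eqP; lia.
by have -> : (x.-1 == n) = false by apply/negP => /eqP; lia.
Qed.

Lemma sum_two_terms (V : zmodType) n r (G : nat -> V) : (r.+1 < n)%N ->
  (forall a, (a < n)%N -> a != r -> a != r.+1 -> G a = 0) ->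
  \sum_(a < n) G a = G r + G r.+1.
Proof.
move=> lt_rn G0; rewrite (bigD1 (Ordinal (ltnW lt_rn))) //=.
rewrite (bigD1 (Ordinal lt_rn)) /=; last by rewrite -val_eqE /= gtn_eqF.
by rewrite big1 ?addr0 // => a /andP[]; rewrite -!val_eqE => neq_r neq_r1; apply: G0.
Qed.

(** Splitting a letter adds the single partial sum [sumn s + a]. *)
Lemma covered_split s t n a x : (a <= n)%N ->
  covered (s ++ a :: (n - a)%N :: t) x =
  covered (s ++ n :: t) x || (x == sumn s + a)%N || (x.-1 == sumn s + a)%N.
Proof.
move=> le_an.
have memE y : (y \in psums 0 (s ++ a :: (n - a)%N :: t)) =
    (y \in psums 0 (s ++ n :: t)) || (y == sumn s + a)%N.
  rewrite !mem_psums_cat !mem_psums_cons !add0n -[(sumn s + a + _)%N]addnA subnKC //.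
  by case: (y \in psums 0 s) => //=; case: (y == sumn s) => //=; rewrite orbC.
rewrite /covered !memE; case: (x \in _) => //=.
by case: (x == _) => //=; rewrite ?orbT ?orbF.
Qed.

(** The last factor is half the power of 2 coming from the letters [a] and [k - a]. If [P] is
    already covered before splitting, the sum telescopes. Otherwise an uncovered peak [x] is covered
    only when the new partial sum is [x - 1] or [x]; these two consecutive terms cancel. *)
Lemma alternating_covered n P s t k : is_peak_set n P -> (0 < k)%N ->
  sumn (s ++ k :: t) = n ->
  \sum_(a < k.+1) (-1) ^+ a *
    ((all (covered (s ++ (a : nat) :: (k - a)%N :: t)) P)%:R *
     ((0 < a)%N%:R + (a < k)%N%:R)) = 0 :> K.
Proof.
move=> peakP k_gt0 sum_n; set p := sumn s.
pose q := covered (s ++ k :: t).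
have [allq|/allPn[x xP xq]] := boolP (all q P).
  have -> : \sum_(a < k.+1) (-1) ^+ a *
      ((all (covered (s ++ (a : nat) :: (k - a)%N :: t)) P)%:R *
       ((0 < a)%N%:R + (a < k)%N%:R)) =
      \sum_(a < k.+1) (-1) ^+ a * (0 < a)%N%:R
      + \sum_(a < k.+1) (-1) ^+ a * (a < k)%N%:R :> K.
    rewrite -big_split; apply: eq_bigr => a _.
    rewrite (_ : all _ _ = true) ?mul1r ?mulrDr //.
    apply/allP => y /(allP allq); rewrite covered_split; last by rewrite -ltnS.
    by rewrite /q => ->.
  (* Dropping the zero terms [a = 0] and [a = k] leaves two sums that cancel after a shift of the
     index. *)
  rewrite big_ord_recl [X in _ + X]big_ord_recr /= ltnn !mulr0 add0r addr0.
  rewrite -big_split big1 // => a _ /=.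
  by rewrite ltn_ord !mulr1 exprS mulN1r addNr.
have [/andP[x_ge2 x_lt] xP'] := peakP x xP.
have qin y : y \in psums 0 (s ++ k :: t) -> (x != y) && (x.-1 != y).
  by move=> yw; rewrite -negb_or; apply: contra xq => /orP[/eqP e|/eqP e];
    rewrite /q /covered e yw ?orbT.
have /andP[/eqP x_p /eqP x1_p] : (x != p) && (x.-1 != p).
  by apply: qin; rewrite mem_psums_cat (psums_end 0).
have /andP[/eqP x_pk /eqP x1_pk] : (x != p + k)%N && (x.-1 != p + k)%N.
  by apply: qin; rewrite mem_psums_cat mem_psums_cons psums_start !orbT.
have cov0 a : (a <= k)%N -> x != (p + a)%N -> x.-1 != (p + a)%N ->
    all (covered (s ++ a :: (k - a)%N :: t)) P = false.
  move=> le_ak xa x1a; apply/negP => /allP/(_ x xP).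
  by rewrite covered_split // -/p -/(q x) (negbTE xq) (negbTE xa) (negbTE x1a).
(* If [x - 1] is not strictly inside the block of [k], no split covers [x]. *)
have [in_range|out_range] := boolP (p < x.-1 < p + k)%N; last first.
  apply: big1 => a _; have le_ak : (a <= k)%N by rewrite -ltnS.
  by rewrite cov0 ?mul0r ?mulr0 //; apply/eqP; lia.
have in_range' : (x < p + k)%N by lia.
(* The splits at [r] and [r.+1] create the partial sums [x - 1] and [x]. *)
pose r := (x.-1 - p)%N.
(* A peak other than [x] that only the new partial sum covers would be [x - 1] or [x + 1], adjacent
   to [x]. *)
have covE a : (a <= k)%N -> a = r \/ a = r.+1 ->
    all (covered (s ++ a :: (k - a)%N :: t)) P = all (fun y => q y || (y == x)) P.
  move=> le_ak def_a; apply: eq_in_all => y yP.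
  rewrite covered_split // -/p -/(q y) -orbA; congr (_ || _).
  have [/andP[y_ge2 _] yP'] := peakP y yP.
  have [->|neq_yx] := eqVneq y x.
    by apply/orP; case: def_a => ->; [right | left]; apply/eqP; lia.
  apply/negP => /orP[]/eqP eq_y.
    case: def_a => def_a; last by case/eqP: neq_yx; lia.
    by case/negP: xP'; have <- : y = x.-1 by lia.
  case: def_a => def_a; first by case/eqP: neq_yx; lia.
  by case/negP: yP'; have -> : y.-1 = x by lia.
rewrite (@sum_two_terms _ _ r (fun a => (-1) ^+ a *
    ((all (covered (s ++ (a : nat) :: (k - a)%N :: t)) P)%:R *
     ((0 < a)%N%:R + (a < k)%N%:R)))); last 2 first.
- lia.
- move=> a; rewrite ltnS => le_ak /eqP neq_r /eqP neq_r1.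
  by rewrite cov0 ?mul0r ?mulr0 //; apply/eqP; lia.
rewrite !covE; try lia; try by [left | right].
have -> : (0 < r)%N by lia.
have -> : (r < k)%N by lia.
have -> : (r.+1 < k)%N by lia.
by rewrite exprS mulN1r mulNr addrN.
Qed.

Lemma cancelling_peak_function n P : (0 < n)%N -> is_peak_set n P ->
  cancelling (peak_function K n P).
Proof.
move=> n_gt0 peakP; apply/cancelling_wordP; split=> [s t|s t k k_gt0].
  rewrite !peak_function_word // !count_cat !sumn_cat /=.
  congr ((_ && _)%:R * _); apply: eq_all => x; rewrite /covered !mem_psums_cat.
  rewrite !mem_psums_cons addn0.
  by rewrite !(orb_idl (_ : (_ == _) -> _)) // => /eqP->; apply: psums_start.
have [sum_n|sum_n] := eqVneq (sumn (s ++ k :: t)) n; last first.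
  apply: big1 => a _; rewrite peak_function_word //.
  suff -> : (sumn (s ++ (a : nat) :: (k - a)%N :: t) == n) = false by rewrite mul0r mulr0.
  rewrite -(negbTE sum_n) !sumn_cat /= [(a + _)%N]addnA subnKC //.
  by rewrite -ltnS.
(* The common factor collects the other nonzero letters and one 2, so that half the weight of the
   pair remains. *)
transitivity (2%:R ^+ (count (predC1 0%N) (s ++ t)).+1 *
  \sum_(a < k.+1) (-1) ^+ a *
    ((all (covered (s ++ (a : nat) :: (k - a)%N :: t)) P)%:R *
     ((0 < a)%N%:R + (a < k)%N%:R)) : K); last first.
  by rewrite (alternating_covered peakP) // mulr0.
rewrite big_distrr /=; apply: eq_bigr => a _.
have le_ak : (a <= k)%N by rewrite -ltnS.
rewrite [RHS]mulrCA; congr (_ * _); rewrite peak_function_word //.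
have -> : (sumn (s ++ (a : nat) :: (k - a)%N :: t) == n).
  by rewrite -sum_n !sumn_cat /= [(a + _)%N]addnA subnKC.
rewrite /= mulrCA; congr (_ * _); rewrite !count_cat /= -!lt0n subn_gt0.
have -> : (count (predC1 0%N) s + ((0 < a) + ((a < k) + count (predC1 0%N) t)) =
   (count (predC1 0%N) s + count (predC1 0%N) t) + ((0 < a) + (a < k)))%N by lia.
rewrite exprD exprSr -mulrA; congr (_ * _).
have : (0 < a)%N || (a < k)%N by lia.
by case: (0 < a)%N; case: (a < k)%N => //= _; rewrite ?addr0 ?add0r ?mulr1 // mulrDr mulr1.
Qed.

End PeakCoefficients.

(** * The functions [q_n] and the algebra [Omega] *)

Section OmegaAlgebra.
Variable K : comNzRingType.
Implicit Types (s t w : seq nat) (f g : series K).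

Lemma series_var_mul_word f s b t :
  (series_var K (size s) * f) (word_monomial (s ++ b :: t)) =
  if b is b'.+1 then f (word_monomial (s ++ b' :: t)) else 0.
Proof.
set i := size s; set m := word_monomial _.
have mi : m i = b by rewrite /m word_monomialE nth_cat ltnn subnn.
case: b => [|b] in m mi *; first by rewrite series_var_mul_notin // -mset_eq0 mi.
transitivity (\sum_(a <- mdivisors m) (a == [mset i]%mset)%:R * f (m `\` a)%mset) => //.
have im : [mset i]%mset \in mdivisors m.
  rewrite in_mdivisors; apply/msubsetP => x; rewrite msetnE.
  by case: eqP => // ->; rewrite mi.
rewrite (big_fsetD1 _ im) /= eqxx mul1r big_seq big1 ?addr0 => [|a].
  congr (f _); apply/msetP => x; rewrite msetB1E !word_monomialE !nth_cat.
  have [lt|gt|->] := ltngtP x (size s); rewrite ?subn0 ?subnn ?subn1 //=.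
  by have -> : (x - size s = (x - size s).-1.+1)%N by lia.
by rewrite !inE => /andP[/negbTE-> _]; rewrite mul0r.
Qed.

Lemma series_var_exp_word k f s b t :
  (series_var K (size s) ^+ k * f) (word_monomial (s ++ b :: t)) =
  if (k <= b)%N then f (word_monomial (s ++ (b - k)%N :: t)) else 0.
Proof.
elim: k b => [|k IHk] b; first by rewrite expr0 mul1r subn0.
by rewrite exprS -mulrA series_var_mul_word; case: b.
Qed.

(** This is the expansion of [(1 + x z) / (1 - x z)] as 1 plus twice the sum of the [x ^ k z ^ k]
    with [k > 0]. *)
Lemma q_factor_coef (x : series K) n k : (k <= n)%N ->
  ((1 + x%:P * 'X) * \poly_(j < n.+1) x ^+ j)`_k = 2%:R ^+ (k != 0)%N *: x ^+ k.
Proof.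
move=> le_kn; rewrite mulrDl mul1r -mulrA coefD coefCM coefXM !coef_poly ltnS le_kn.
case: k le_kn => [|k] le_kn; first by rewrite mulr0 addr0 scale1r.
by rewrite ltnS (ltnW le_kn) /= -exprS expr1 scaler_nat mulr2n.
Qed.

(** At the letter [b] only the power [k = b] of the new variable counts: a smaller one leaves a
    nonzero letter where [p] has no coefficient, a larger one exceeds the exponent. *)
Lemma q_product_step (p l : {poly series K}) n j s b t : (j <= n)%N ->
  (forall k, (k <= n)%N -> l`_k = 2%:R ^+ (k != 0)%N *: series_var K (size s) ^+ k) ->
  (forall k u, (k <= n)%N -> p`_k (word_monomial (s ++ u)) =
     ((sumn s == k) && all (pred1 0%N) u)%:R * 2%:R ^+ count (predC1 0%N) s) ->
  (p * l)`_j (word_monomial (s ++ b :: t)) =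
  ((sumn s + b == j)%N && all (pred1 0%N) t)%:R *
    2%:R ^+ (count (predC1 0%N) s + (b != 0))%N.
Proof.
move=> le_jn coefl coefp.
have -> : (p * l)`_j = \sum_(k < j.+1) l`_k * p`_(j - k) by rewrite mulrC coefM.
rewrite series_sumE.
transitivity (\sum_(k < j.+1) if (k : nat) == b then
   2%:R ^+ (k != 0 :> nat)%N * (((sumn s == j - k)%N && all (pred1 0%N) t)%:R *
     2%:R ^+ count (predC1 0%N) s) else 0 : K).
  apply: eq_bigr => k _; have le_kj : (k <= j)%N by rewrite -ltnS.
  rewrite coefl ?(leq_trans le_kj) // -scalerAl.
  move: (coefp (j - k)%N); set c := p`_(j - k) => coefc.
  transitivity (2%:R ^+ (k != 0 :> nat)%N *
    (series_var K (size s) ^+ k * c) (word_monomial (s ++ b :: t))) => //.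
  rewrite series_var_exp_word; have [lt_kb|lt_bk|eq_kb] := ltngtP (k : nat) b.
  - rewrite coefc ?(leq_trans (leq_subr _ _)) //= subn_eq0 leqNgt lt_kb.
    by rewrite andbF mul0r mulr0.
  - by rewrite mulr0.
  - by rewrite -eq_kb subnn coefc ?(leq_trans (leq_subr _ _)).
rewrite -big_mkcond /=.
have [le_bj|lt_jb] := leqP b j.
  have lt_b : (b < j.+1)%N by [].
  rewrite (big_pred1 (Ordinal lt_b)) //.
  have -> : (sumn s + b == j)%N = (sumn s == j - b)%N.
    by rewrite -{1}(subnK le_bj) eqn_add2r.
  by rewrite /= mulrCA -exprD addnC.
rewrite big1 => [|k /eqP eq_kb]; last by have := ltn_ord k; lia.
have -> : (sumn s + b == j)%N = false by apply/negP => /eqP; lia.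
by rewrite mul0r.
Qed.

Lemma q_product_word n N j s t : size s = N -> (j <= n)%N ->
  (\prod_(i < N) ((1 + (series_var K i)%:P * 'X) *
                  \poly_(k < n.+1) series_var K i ^+ k))`_j
    (word_monomial (s ++ t)) =
  ((sumn s == j) && all (pred1 0%N) t)%:R * 2%:R ^+ count (predC1 0%N) s.
Proof.
elim: N j s t => [|N IHN] j s t.
  case: s => // _ _; rewrite big_ord0 coef1 mulr1 /= eq_sym.
  case: eqP => //= _; transitivity ((word_monomial t == mset0)%:R : K) => //.
  congr (nat_of_bool _)%:R; apply/eqP/allP => [/msetP t0 x /(nthP 0%N)[i _ <-]|t0].
    by rewrite -word_monomialE t0 mset0E /=.
  apply/msetP => i; rewrite word_monomialE mset0E.
  have [lt_i|] := ltnP i (size t); last exact: nth_default.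
  by apply/eqP; apply: (t0 _ (mem_nth _ lt_i)).
case/lastP: s => // s b; rewrite size_rcons => -[sN] le_jn.
rewrite cat_rcons sumn_rcons -cats1 count_cat big_ord_recr.
move: IHN; move: (\prod_(i < N) _) => p IHN.
rewrite (@q_product_step _ _ n) //=; first by rewrite addn0.
  by move=> k le_kn; rewrite sN q_factor_coef.
by move=> k u le_kn; rewrite IHN.
Qed.

Lemma q_function_word n w :
  q_function K n (word_monomial w) = (sumn w == n)%:R * 2%:R ^+ count (predC1 0%N) w.
Proof.
rewrite -(@q_partial_stable _ (size w)).
  by have := @q_product_word n (size w) n w [::] erefl (leqnn n); rewrite cats0 andbT.
apply/bigmax_leqP_seq => i; rewrite in_mset word_monomialE => wi _.
by rewrite ltnNge; apply: contraL wi => /(nth_default 0%N)->.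
Qed.

Lemma q_function0 : q_function K 0 = 1.
Proof.
apply/funext => m; have [w _ ->] := word_monomial_exists 0 m.
have := @q_product_word 0 0 0 [::] w erefl isT.
rewrite big_ord0 coef1 eqxx mulr1n /= => ->.
rewrite q_function_word mulr1; case: (boolP (all _ w)) => [w0|].
  have -> : count (predC1 0%N) w = 0%N.
    by apply/eqP; rewrite -leqn0 leqNgt -has_count -all_predC; apply: sub_all w0 => x /= ->.
  have -> : sumn w = 0%N by elim: w w0 => //= k w IHw /andP[/eqP-> /IHw].
  by rewrite mulr1.
rewrite -has_predC => w0; have -> : (sumn w == 0)%N = false; last by rewrite mul0r.
elim: w w0 => //= k w IHw /orP[|/IHw]; first by case: k.
by rewrite addn_eq0 => ->; rewrite andbF.
Qed.

(** Both sides have the same coefficients at words; the generators of [Omega] thereby inherit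
    cancellation and degree bounds from the peak functions. *)
Lemma q_function_peak n : (0 < n)%N -> q_function K n = peak_function K n fset0.
Proof.
move=> n_gt0; apply/funext => m; have [w _ ->] := word_monomial_exists 0 m.
rewrite q_function_word peak_function_word // (_ : all _ _ = true) ?andbT //.
Qed.

Lemma hasse_q_function k n : hasse 0 k (q_function K n) =
  if (k <= n)%N then 2%:R ^+ (k != 0)%N *: q_function K (n - k) else 0.
Proof.
apply/funext => m; have [w _ ->] := word_monomial_exists 0 m.
rewrite (hasse_word k _ [::]) q_function_word /=.
have [le_kn|lt_nk] := leqP k n; last first.
  have -> : (k + sumn w == n)%N = false by apply/negP => /eqP; lia.
  by rewrite mul0r.
transitivity (2%:R ^+ (k != 0)%N * q_function K (n - k) (word_monomial w)) => //.
rewrite q_function_word mulrCA -exprD -(eqn_add2l k _ (n - k)) subnKC //.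
Qed.

(** The series satisfying [Q] form a subalgebra containing the generators. *)
Lemma Omega_ind (Q : series K -> Prop) :
  Q 1 -> (forall c f g, Q f -> Q g -> Q (c *: f + g)) ->
  (forall f g, Q f -> Q g -> Q (f * g)) ->
  (forall n, (0 < n)%N -> Q (q_function K n)) ->
  forall f, Omega f -> Q f.
Proof.
move=> Q1 QD QM Qq f /(_ [pred f | `[< Q f >]]) Of; apply/asboolP; apply: Of.
  split=> [|c g h|g h]; first exact/asboolP.
    by move=> /asboolP Qg /asboolP Qh; apply/asboolP; apply: QD.
  by move=> /asboolP Qg /asboolP Qh; apply/asboolP; apply: QM.
by move=> _ [n n_gt0 ->]; apply/asboolP; apply: Qq.
Qed.

Lemma Omega1 : Omega (1 : series K).
Proof. by move=> S [S1 _ _] _. Qed.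

Lemma OmegaD c f g : Omega f -> Omega g -> Omega (c *: f + g).
Proof.
move=> Of Og S clS qS; have [_ SD _] := clS.
by apply: SD; [apply: Of | apply: Og].
Qed.

Lemma OmegaM f g : Omega f -> Omega g -> Omega (f * g).
Proof.
move=> Of Og S clS qS; have [_ _ SM] := clS.
by apply: SM; [apply: Of | apply: Og].
Qed.

Lemma Omega_q n : Omega (q_function K n).
Proof.
have [->|n_gt0] := posnP n; first by rewrite q_function0; apply: Omega1.
by move=> S _; apply; exists n.
Qed.

Lemma Omega0 : Omega (0 : series K).
Proof. by rewrite -(addNr 1) -scaleN1r; apply: OmegaD; apply: Omega1. Qed.

Lemma OmegaZ c f : Omega f -> Omega (c *: f).
Proof. by move=> Of; rewrite -[_ *: _]addr0; apply: OmegaD => //; apply: Omega0. Qed.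

Lemma Omega_add f g : Omega f -> Omega g -> Omega (f + g).
Proof. by move=> Of Og; rewrite -[f]scale1r; apply: OmegaD. Qed.

Lemma Omega_sum (I : Type) (r : seq I) (P : pred I) (F : I -> series K) :
  (forall i, P i -> Omega (F i)) -> Omega (\sum_(i <- r | P i) F i).
Proof. by move=> OF; apply: big_ind => //; [apply: Omega0 | apply: Omega_add]. Qed.

Lemma Omega_hasse k f : Omega f -> Omega (hasse 0 k f).
Proof.
move=> Of; apply: (Omega_ind (Q := fun f => forall k, Omega (hasse 0 k f))) Of k.
- move=> k; rewrite hasse1; case: eqP => _; [exact: Omega1 | exact: Omega0].
- by move=> c g h Og Oh k; rewrite hasse_is_linear; apply: OmegaD.
- by move=> g h Og Oh k; rewrite hasseM; apply: Omega_sum => j _; apply: OmegaM.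
- move=> n n_gt0 k; rewrite hasse_q_function.
  by case: ifP => _; [apply/OmegaZ/Omega_q | apply: Omega0].
Qed.

Lemma degree_lt_peak_function n P : degree_lt n.+1 (peak_function K n P).
Proof.
move=> m lt_nm; have [w _ def_m] := word_monomial_exists 0 m.
transitivity (2%:R ^+ #|` P|.+1 * (\sum_(a : n.-bseq 'I_n.+1 |
        is_composition n (map val a) &&
        (P `<=` (let D := descents (map val a) in
                 sym_diff D [fset x.+1 | x in D]))%fset)
      fundamental K (map val a)) m) => //.
rewrite series_sumE big1 ?mulr0 // => a /andP[/andP[a0 /eqP an] _].
rewrite def_m fundamental_word // an; move: lt_nm.
by rewrite def_m size_word_monomial; case: eqP => //= ->; rewrite ltnn.
Qed.

Lemma Omega_cancelling f : Omega f -> cancelling f.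
Proof.
apply: Omega_ind; [exact: cancelling1 | exact: cancellingD | exact: cancellingM |].
by move=> n n_gt0; rewrite q_function_peak //; apply: cancelling_peak_function.
Qed.

Lemma Omega_bounded f : Omega f -> exists d, degree_lt d f.
Proof.
move=> Of; apply: (Omega_ind (Q := fun f => exists d, degree_lt d f)) Of
  => [|c g h [d gd] [e he]|g h [d gd] [e he]|n n_gt0].
- by exists 1%N; apply: degree_lt1.
- exists (maxn d e); apply: degree_ltD; first exact: degree_ltW (leq_maxl _ _) gd.
  exact: degree_ltW (leq_maxr _ _) he.
- by exists (d + e)%N; apply: degree_ltM.
- by exists n.+1; rewrite q_function_peak //; apply: degree_lt_peak_function.
Qed.

End OmegaAlgebra.

(** * Spans with restricted coefficients, and bases modulo a subspace *)

Section Spans.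
Variables (R : nzRingType) (V : lmodType R).
Implicit Types (S : set R) (X : set V) (u v : V).

(** Restricting the coefficients to a set covers both the [K]-spans and the [Omega]-combinations in
    the series ring acting on itself. *)
Definition span_over S X : set V := fun v =>
  exists (s : {fset V}) (c : V -> R),
    (forall x, x \in s -> X x /\ S (c x)) /\ v = \sum_(x <- s) c x *: x.

Lemma span_over_ind S X (Q : V -> Prop) :
  Q 0 -> (forall u v, Q u -> Q v -> Q (u + v)) ->
  (forall a x, S a -> X x -> Q (a *: x)) -> forall v, span_over S X v -> Q v.
Proof.
move=> Q0 QD QZ _ [s [c [sX ->]]]; rewrite big_seq.
by apply: big_ind => // x /sX[Xx Sx]; apply: QZ.
Qed.

Lemma span_over0 S X : span_over S X 0.
Proof. by exists fset0, (fun=> 0); split=> [x|]; rewrite ?inE ?big_seq_fset0. Qed.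

Lemma span_over_gen S X a x : S a -> X x -> span_over S X (a *: x).
Proof.
move=> Sa Xx; exists [fset x]%fset, (fun=> a); rewrite big_seq_fset1; split=> // y.
by rewrite inE => /eqP->.
Qed.

Lemma span_overD S X u v : S 0 -> (forall a b, S a -> S b -> S (a + b)) ->
  span_over S X u -> span_over S X v -> span_over S X (u + v).
Proof.
move=> S0 SD [s [c [sX ->]]] [t [d [tX ->]]].
(* Extension of the coefficients by 0 lets both sums run over the union. *)
pose ext (r : {fset V}) (e : V -> R) x := if x \in r then e x else 0.
have extE (r r' : {fset V}) (e : V -> R) : (r `<=` r')%fset ->
    \sum_(x <- r) e x *: x = \sum_(x <- r') ext r e x *: x.
  move=> sub_r; rewrite -[RHS](big_fset_incl _ sub_r) => [|x _ /negbTE r'x].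
    by rewrite big_seq [RHS]big_seq; apply: eq_bigr => x; rewrite /ext => ->.
  by rewrite /ext r'x scale0r.
exists (s `|` t)%fset, (fun x => ext s c x + ext t d x); split=> [x|].
  rewrite in_fsetU /ext => st; split; first by case/orP: st => [/sX[]|/tX[]].
  apply: SD; first by case: ifP => [/sX[]|].
  by case: ifP => [/tX[]|].
rewrite (extE s (s `|` t)%fset) ?fsubsetUl // (extE t (s `|` t)%fset) ?fsubsetUr //.
by rewrite -big_split; apply: eq_bigr => x _; rewrite scalerDl.
Qed.

Lemma span_overZ S X a v : (forall b, S b -> S (a * b)) ->
  span_over S X v -> span_over S X (a *: v).
Proof.
move=> SM [s [c [sX ->]]]; exists s, (fun x => a * c x); split=> [x /sX[Xx Sx]|].
  by split=> //; apply: SM.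
by rewrite scaler_sumr; apply: eq_bigr => x _; rewrite scalerA.
Qed.

End Spans.

Lemma sum_pick_fset (K : nzRingType) (V : lmodType K) (s : {fset V}) (c : V -> K) y :
  y \in s -> \sum_(x <- s) (if x == y then c x else 0) *: x = c y *: y.
Proof.
move=> ys; rewrite (big_fsetD1 _ ys) /= eqxx big_seq big1 ?addr0 // => x.
by rewrite !inE => /andP[/negbTE-> _]; rewrite scale0r.
Qed.

(** Greedy selection: a vector is added unless it is already a combination of the selected ones
    modulo [N]. *)
Lemma basis_modulo (K : fieldType) (V : lmodType K) (N : set V) (r : seq V) :
  N 0 -> (forall a u v, N u -> N v -> N (a *: u + v)) ->
  exists s : {fset V},
    [/\ forall x, x \in s -> x \in r,
        forall c : V -> K, N (\sum_(x <- s) c x *: x) -> forall x, x \in s -> c x = 0 &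
        forall y, y \in r -> exists c : V -> K, N (y - \sum_(x <- s) c x *: x)].
Proof.
move=> N0 ND; elim: r => [|y r [s [sr indep gen]]].
  by exists fset0; split=> // x; rewrite inE.
have [ys|ys] := pselect (exists c : V -> K, N (y - \sum_(x <- s) c x *: x)).
  exists s; split=> // x; first by move=> /sr xr; rewrite inE xr orbT.
  by rewrite inE => /orP[/eqP->|/gen].
have y_s : y \notin s.
  apply/negP => y_s; case: ys; exists (fun x => if x == y then 1 else 0).
  by rewrite sum_pick_fset // scale1r subrr.
have bigU (c : V -> K) : \sum_(x <- (y |` s)%fset) c x *: x =
    c y *: y + \sum_(x <- s) c x *: x by rewrite big_fsetU1.
exists (y |` s)%fset; split=> [x|c|x].
- by rewrite !inE => /orP[->//|/sr->]; rewrite orbT.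
- rewrite bigU => Nc; have c_y : c y = 0.
    have [//|cy0] := eqVneq (c y) 0; case: ys; exists (fun x => - ((c y)^-1 * c x)).
    have := ND (c y)^-1 _ _ Nc N0; rewrite addr0 scalerDr scalerA mulVf // scale1r.
    rewrite scaler_sumr -sumrN; congr (N (_ + _)); apply: eq_bigr => x _.
    by rewrite scalerA scaleNr opprK.
  move: Nc; rewrite c_y scale0r add0r => /indep cs x; rewrite !inE.
  by case/orP=> [/eqP->|/cs].
- rewrite inE => /orP[/eqP->|/gen[c Nc]].
    exists (fun x => if x == y then 1 else 0).
    by rewrite sum_pick_fset ?inE ?eqxx // scale1r subrr.
  exists (fun x => if x == y then 0 else c x); rewrite bigU eqxx scale0r add0r.
  rewrite (eq_big_seq (fun x => c x *: x)) // => z zs.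
  by case: eqP => // zy; rewrite -zy zs in y_s.
Qed.

(** * Reduction to words whose descent set is a peak set *)

Section WordReduction.
Local Open Scope nat_scope.
Implicit Types (s t w : seq nat).

Fixpoint peak_word w : bool :=
  if w is k :: w' then (w' == [::]) || (1 < k) && peak_word w' else true.

Lemma peak_word_split w : ~~ peak_word w ->
  exists s k l t, w = s ++ k :: l :: t /\ k <= 1.
Proof.
elim: w => //= k w IHw; rewrite negb_or negb_and => /andP[w0 /orP[|/IHw]].
  rewrite -leqNgt => k_le1; case: w w0 {IHw} => // l t _.
  by exists [::], k, l, t.
by move=> [s [a [l [t [-> a_le1]]]]]; exists (k :: s), a, l, t.
Qed.

(** Every letter but the last exceeds 1, so a gap of 1 can occur only at the end. *)
Lemma peak_word_gap p w x : peak_word w ->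
  x \in psums p w -> x.+1 \in psums p w -> x.+1 = p + sumn w.
Proof.
elim: w p => [|k w IHw] p /=; first by rewrite !inE => _ /eqP-> /eqP; lia.
rewrite !mem_psums_cons addnA; case/orP => [/eqP->|/andP[k_gt1 pk]].
  by rewrite /psums /= !inE addn0 => /orP[]/eqP-> /orP[]/eqP; lia.
case/orP=> [/eqP->|xw]; case/orP => [/eqP|xw1].
- lia.
- by have := psums_bounds xw1; lia.
- by have := psums_bounds xw; lia.
- exact: IHw.
Qed.

Lemma peak_word_descents n w : is_composition n w -> peak_word w ->
  is_peak_set n (descents w).
Proof.
move=> /andP[w0 /eqP wn] pk x; rewrite descents_inner // !in_inner_psums wn.
case/and3P=> xw x_gt0 x_lt; have gap := @peak_word_gap 0 w _ pk.
split; last first.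
  apply/negP => /andP[x1w _]; have := gap _ x1w; rewrite prednK // => /(_ xw).
  by rewrite add0n wn; lia.
suff : x != 1 by lia.
apply/eqP => x1; have := gap 0 (psums_start _ _); rewrite -x1 => /(_ xw).
by rewrite add0n wn; lia.
Qed.

(** This measure drops when part of a letter moves to the left, which makes the rewriting in
    [cancelling_eq0] terminate. *)
Fixpoint weight i w : nat := if w is k :: w' then i * k + weight i.+1 w' else 0.

Lemma weight_cat i s t : weight i (s ++ t) = weight i s + weight (i + size s) t.
Proof.
by elim: s i => [|k s IHs] i /=; rewrite ?addn0 // IHs addnA addSnnS.
Qed.

Lemma weight_mono i j w : i <= j -> weight i w <= weight j w.
Proof.
elim: w i j => //= k w IHw i j le_ij; apply: leq_add; last exact: IHw.
by rewrite leq_mul2r le_ij orbT.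
Qed.

Lemma weight_filter i w : weight i [seq k <- w | k != 0] <= weight i w.
Proof.
elim: w i => //= k w IHw i; case: eqP => [->|_] /=; last by rewrite leq_add2l.
by rewrite muln0 add0n (leq_trans _ (IHw _)) // weight_mono.
Qed.

End WordReduction.

Section Determination.
Variable K : comNzRingType.
Implicit Types (f : series K) (s t w : seq nat).

Lemma cancelling_filter f w : cancelling f ->
  f (word_monomial [seq k <- w | k != 0%N]) = f (word_monomial w).
Proof.
move=> /cancelling_wordP[f0 _]; rewrite -[w in RHS]cat0s -[filter _ _]cat0s.
elim: w [::] => // k w IHw s /=; have [->|_] /= := eqVneq k 0%N.
  by rewrite IHw f0.
by rewrite -!cat_rcons IHw.
Qed.

(* A letter 1 that is not the last one can be eliminated: with N = 1 + l
   the coefficient at s ++ 1 :: l :: t is a combination of those at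
   s ++ a :: (N - a) :: t with a != 1, which are of smaller weight. *)
Lemma cancelling_eq0 n f : cancelling f ->
  (forall w, is_composition n w -> is_peak_set n (descents w) ->
    f (word_monomial w) = 0) ->
  forall w, sumn w = n -> f (word_monomial w) = 0.
Proof.
move=> canf f_peak w; have [b] := ubnP (weight 0 w).
elim: b w => // b IHb w lt_wb wn; rewrite -cancelling_filter //.
set w' := filter _ w; have w'n : sumn w' = n.
  by rewrite -wn /w'; elim: (w) => //= k u IHu; case: eqP => [->|_] /=; rewrite IHu.
have w'0 : 0%N \notin w' by rewrite mem_filter eqxx.
have {}lt_wb : (weight 0 w' < b.+1)%N := leq_ltn_trans (weight_filter 0 w) lt_wb.
have comp_w' : is_composition n w' by rewrite /is_composition w'0 w'n eqxx.
have [/(peak_word_descents comp_w')|] := boolP (peak_word w'); first exact: f_peak.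
move=> /peak_word_split[s [k [l [t [def_w k_le1]]]]].
have k1 : k = 1%N.
  by move: w'0; rewrite def_w mem_cat inE; case: k k_le1 {def_w} => [|[]]; rewrite ?orbT.
have l_gt0 : (0 < l)%N.
  by move: w'0; rewrite def_w mem_cat !inE; case: l {def_w}; rewrite ?orbT.
have [f0 /(_ s t l.+1 isT)] := (cancelling_wordP f).1 canf.
rewrite def_w k1 in lt_wb w'n *; rewrite weight_cat /= in lt_wb.
rewrite sumn_cat /= in w'n.
have lt1 : (1 < l.+2)%N by [].
(* The term [a = 1] has coefficient -1, so it vanishes once all the others do. *)
rewrite (bigD1 (Ordinal lt1)) //= subn1 /= big1 => [|a neq_a1].
  by rewrite addr0 mulN1r => /eqP; rewrite oppr_eq0 => /eqP.
have le_al : (a <= l.+1)%N by rewrite -ltnS.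
(* For [a = 0] the zero letter is erased; the weight drops by at least [l > 0]. *)
have [a0|a_gt0] := posnP a.
  rewrite a0 f0 subn0 IHb ?mulr0 ?sumn_cat /=; [by []| |by rewrite -w'n].
  rewrite weight_cat /=; have := weight_mono t (leqnSn (0 + size s).+1).
  by move: lt_wb; nia.
have a_gt1 : (1 < a)%N.
  by rewrite ltn_neqAle a_gt0 andbT eq_sym; move: neq_a1; rewrite -val_eqE.
rewrite IHb ?mulr0 ?sumn_cat /=; [by []| |by rewrite -w'n; lia].
by rewrite weight_cat /=; move: lt_wb; rewrite muln1; nia.
Qed.

End Determination.

(** * The order on peak sets and triangular systems *)

Section Triangularity.
Implicit Types (P Q : {fset nat}) (n : nat).

Definition depth n P : nat := \sum_(x <- P) (n - x).

Lemma leq_sum_fsubset (A B : {fset nat}) (F : nat -> nat) : (A `<=` B)%fset ->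
  (\sum_(x <- B) F x = \sum_(x <- A) F x + \sum_(x <- (B `\` A)%fset) F x)%N.
Proof.
move=> sub; rewrite (big_fsetID _ (mem A)) /=; congr (_ + _)%N; apply: eq_fbigl => x.
  by rewrite !inE /= andb_idl //; apply: (fsubsetP sub).
by rewrite !inE /= andbC.
Qed.

(** Sending each [x] of [P] to [x] if it lies in [Q], else to [x - 1], is injective since peaks are
    not adjacent. Every shift increases the distance to [n]; without shifts, the additional elements
    of [Q] increase the depth. *)
Lemma depth_lt n P Q : is_peak_set n P -> (forall x, x \in Q -> (0 < x < n)%N) ->
  (forall x, x \in P -> (x \in Q) || (x.-1 \in Q)) ->
  P = Q \/ (depth n P < depth n Q)%N.
Proof.
move=> peakP Qn cov; pose phi x := if x \in Q then x else x.-1.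
have [sub|/fsubsetPn[y yP yQ]] := boolP (P `<=` Q)%fset.
  have [->|neq_PQ] := eqVneq P Q; [by left | right].
  have /fsubsetPn[x xQ xP] : ~~ (Q `<=` P)%fset.
    by apply: contra neq_PQ => subQP; rewrite eqEfsubset sub.
  rewrite /depth (leq_sum_fsubset _ sub) -[X in (X < _)%N]addn0 ltn_add2l.
  have xQP : x \in (Q `\` P)%fset by rewrite !inE xP.
  by rewrite (big_fsetD1 _ xQP) /=; have := Qn x xQ; lia.
right; have phi_inj : {in P &, injective phi}.
  move=> x z xP zP; rewrite /phi.
  have [/andP[x2 _] xP1] := peakP x xP; have [/andP[z2 _] zP1] := peakP z zP.
  case: ifP => _; case: ifP => _ // eq_xz.
  - by case/negP: zP1; rewrite -eq_xz.
  - by case/negP: xP1; rewrite eq_xz.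
  - lia.
have sub : ([fset phi x | x in P] `<=` Q)%fset.
  apply/fsubsetP => _ /imfsetP[x /= xP ->]; rewrite /phi.
  by case: ifP (cov x xP) => //= ->.
rewrite /depth (leq_sum_fsubset _ sub); apply: leq_trans (leq_addr _ _).
rewrite big_imfset //= (big_fsetD1 _ yP) [X in (_ < X)%N](big_fsetD1 _ yP) /=.
rewrite -addSn; apply: leq_add.
  have [/andP[y2 yn] _] := peakP y yP; rewrite /phi (negbTE yQ); lia.
apply: leq_sum => x _; rewrite /phi; case: ifP => _ //; lia.
Qed.

(** The equations are solved by increasing [mu]: changing the coefficients at level [d] leaves the
    equations of lower level intact. *)
Lemma triangular_solve (K : fieldType) (I : eqType) (r : seq I) (mu : I -> nat)
    (k : I -> I -> K) (phi : I -> K) : uniq r ->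
  (forall i, i \in r -> k i i != 0) ->
  (forall i j, i \in r -> j \in r -> k i j != 0 -> i = j \/ (mu i < mu j)%N) ->
  exists c : I -> K, forall j, j \in r -> phi j = \sum_(i <- r) c i * k i j.
Proof.
move=> uniq_r diag tri.
suff [c cP] : exists c : I -> K, forall j, j \in r ->
    (mu j < \max_(i <- r) (mu i).+1)%N -> phi j = \sum_(i <- r) c i * k i j.
  by exists c => j jr; apply: cP => //; apply: (leq_bigmax_seq (F := fun i => (mu i).+1)).
elim: (\max_(i <- r) (mu i).+1) => [|d [c cP]]; first by exists (fun=> 0).
(* The residue of equation [i], divided by the diagonal entry. *)
pose e i := (phi i - \sum_(l <- r) c l * k l i) / k i i.
exists (fun i => c i + (if mu i == d then e i else 0)) => j jr; rewrite ltnS => le_jd.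
under eq_bigr do rewrite mulrDl.
rewrite big_split /= [X in _ + X](bigD1_seq j) //= [X in _ + (_ + X)]big1_seq; last first.
  move=> i /andP[neq_ij ir]; case: eqP => [mu_i|_]; last by rewrite mul0r.
  have [->|/tri[] // eq_or] := eqVneq (k i j) 0; first by rewrite mulr0.
    by rewrite eq_or eqxx in neq_ij.
  by lia.
rewrite addr0; have [mu_j|neq_jd] := eqVneq (mu j) d.
  by rewrite /e divfK ?diag // addrC subrK.
by rewrite mul0r addr0; apply: cP => //; rewrite ltn_neqAle neq_jd.
Qed.

End Triangularity.

(** * [PeakStar] as the space of cancelling series of bounded degree *)

Section PeakStarCharacterization.
Variables (K : fieldType) (two_neq0 : 2%:R != 0 :> K).
Implicit Types (f : series K) (P : {fset nat}).

Definition cancelling_lt (d : nat) : set (series K) :=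
  fun f => cancelling f /\ degree_lt d f.

Lemma cancelling_ltD d c f g : cancelling_lt d f -> cancelling_lt d g ->
  cancelling_lt d (c *: f + g).
Proof.
by move=> [? ?] [? ?]; split; [apply: cancellingD | apply: degree_ltD].
Qed.

Lemma cancelling_lt0 d : cancelling_lt d 0.
Proof.
split=> //; have can1 := cancelling1 K.
by have := cancellingD (-1) can1 can1; rewrite scaleN1r addNr.
Qed.

Lemma cancelling_lt_add d f g :
  cancelling_lt d f -> cancelling_lt d g -> cancelling_lt d (f + g).
Proof. by rewrite -[f in f + g]scale1r; apply: cancelling_ltD. Qed.

Lemma cancelling_ltZ d c f : cancelling_lt d f -> cancelling_lt d (c *: f).
Proof.
by move=> Mf; rewrite -[_ *: _]addr0; apply: cancelling_ltD => //; apply: cancelling_lt0.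
Qed.

Lemma cancelling_ltW d e f : (d <= e)%N -> cancelling_lt d f -> cancelling_lt e f.
Proof. by move=> le_de [canf fd]; split=> //; apply: degree_ltW fd. Qed.

Definition peak_generator f : Prop := f = 1 \/
  exists n P, [/\ (1 <= n)%N, is_peak_set n P & f = peak_function K n P].

(** The top degree [d] can be removed by finitely many generators: a triangular system matches the
    coefficients at the words of peak sets, and [cancelling_eq0] extends the match to all words of
    degree [d]. *)
Lemma cancelling_lt_peel d : exists r : seq (series K),
  (forall y, y \in r -> cancelling_lt d.+1 y /\ peak_generator y) /\
  forall f, cancelling_lt d.+1 f ->
    exists2 v, span_over setT (fun y => y \in r) v & cancelling_lt d (f - v).
Proof.
have [->|d_gt0] := posnP d.
  (* In degree 0 a cancelling series is its constant term. *)
  exists [:: 1]; split=> [y|f [canf f1]].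
    rewrite inE => /eqP->; split; last by left.
    by split; [apply: cancelling1 | apply: degree_lt1].
  exists (f mset0 *: 1); first by apply: span_over_gen; rewrite ?inE.
  rewrite -hasse_eq0_const ?subrr //.
  - exact: cancelling_lt0.
  - exact: canf.1.
  - move=> k k_gt0; apply/funext => m; apply: f1.
    by rewrite size_insert_var; lia.
pose ps := [seq P <- fpowerset (seq_fset tt (iota 1 d.-1)) | `[< is_peak_set d P >]].
have in_ps P : reflect (is_peak_set d P) (P \in ps).
  rewrite mem_filter; apply: (iffP andP) => [[/asboolP]|peakP] //.
  split; first exact/asboolP.
  rewrite fpowersetE; apply/fsubsetP => x /peakP[bx _].
  by rewrite seq_fsetE mem_iota; lia.
(* The test words: [wd P] is the composition of [d] with descent set [P]. *)
have /boolp.choice[wd wdP] : forall P, exists w, P \in ps ->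
    is_composition d w /\ descents w = P.
  move=> P.
  have [/in_ps peakP|] := boolP (P \in ps); last by exists [::].
  have [|a] := @composition_descents_exists d P d_gt0; last by exists a.
  by move=> x /peakP[]; lia.
pose kf P := peak_function K d P.
pose k P Q := kf P (word_monomial (wd Q)).
have kE P Q : P \in ps -> Q \in ps ->
    k P Q = (all (covered (wd Q)) P)%:R * 2%:R ^+ count (predC1 0%N) (wd Q).
  move=> /in_ps peakP /wdP[/andP[_ sumQ] _].
  by rewrite /k /kf peak_function_word // sumQ.
have wd_psums Q x : Q \in ps -> (x \in psums 0 (wd Q)) = [|| x == 0%N, x == d | x \in Q].
  move=> /wdP[/andP[w0 /eqP sumQ] def_Q].
  by rewrite mem_psums_inner sumQ -descents_inner // def_Q.
have solve phi : exists c : {fset nat} -> K, forall Q, Q \in ps ->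
    phi Q = \sum_(P <- ps) c P * k P Q.
  apply: (@triangular_solve _ _ _ (depth d)) => [|P Pps|P Q Pps Qps].
  - by rewrite filter_uniq // fset_uniq.
  - rewrite kE // (_ : all _ _ = true) ?mul1r ?expf_neq0 //.
    by apply/allP => x xP; rewrite /covered wd_psums // xP !orbT.
  - rewrite kE //; case: allP => [cov _|]; last by rewrite mul0r eqxx.
    have peakP := in_ps _ Pps; have peakQ := in_ps _ Qps.
    apply: (depth_lt (peakP)) => [x /peakQ[]|x xP]; first lia.
    have [bx _] := peakP x xP; move: (cov x xP); rewrite /covered !wd_psums //.
    have -> : (x == 0%N) = false by apply/negP => /eqP; lia.
    have -> : (x == d) = false by apply/negP => /eqP; lia.
    have -> : (x.-1 == 0%N) = false by apply/negP => /eqP; lia.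
    by have -> : (x.-1 == d) = false by apply/negP => /eqP; lia.
have Mk P : P \in ps -> cancelling_lt d.+1 (kf P).
  move=> /in_ps peakP; split; first exact: cancelling_peak_function.
  exact: degree_lt_peak_function.
exists (map kf ps); split=> [y /mapP[P Pps ->]|f [canf fd]].
  split; first exact: Mk.
  by right; exists d, P; split=> //; apply/in_ps.
have [c cP] := solve (fun Q => f (word_monomial (wd Q))).
pose v := \sum_(P <- ps) c P *: kf P.
have Mv : cancelling_lt d.+1 v.
  rewrite /v big_seq; apply: big_ind => [|g h Mg Mh|P /Mk MP].
  - exact: cancelling_lt0.
  - exact: cancelling_lt_add.
  - exact: cancelling_ltZ.
have [canfv fvd] : cancelling_lt d.+1 (f - v).
  by rewrite addrC -scaleN1r; apply: cancelling_ltD.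
exists v.
  rewrite /v big_seq; apply: big_ind => [|g h|P Pps]; first exact: span_over0.
    exact: span_overD.
  by apply: span_over_gen => //; apply: map_f.
split=> // m; rewrite leq_eqVlt => /orP[/eqP sz_m|]; last exact: fvd.
have [w _ def_m] := word_monomial_exists 0 m.
rewrite def_m; apply: (cancelling_eq0 canfv (n := d)) => [u comp_u peak_u|].
  have Qps : descents u \in ps by apply/in_ps.
  have [comp_wd desc_wd] := wdP _ Qps.
  have def_u := composition_descents_inj comp_wd comp_u desc_wd.
  transitivity (f (word_monomial u) - v (word_monomial u)) => //.
  rewrite -def_u cP // /v series_sumE; apply/eqP; rewrite subr_eq0; apply/eqP.
  exact: eq_bigr.
by rewrite sz_m def_m size_word_monomial.
Qed.


Lemma PeakStarE f : PeakStar f <-> exists d, cancelling_lt d f.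
Proof.
have spanE g : PeakStar g <-> span_over setT peak_generator g.
  split=> [[s [c [sX ->]]]|[s [c [sX ->]]]]; exists s, c; split=> // x /sX.
  - by move=> gx; split.
  - by case.
split=> [/spanE|[d]].
  move: f; apply: span_over_ind => [|u v [d Mu] [e Mv]|a x _ Xx].
  - by exists 0%N; apply: cancelling_lt0.
  - exists (maxn d e); apply: cancelling_lt_add.
      exact: cancelling_ltW (leq_maxl _ _) Mu.
    exact: cancelling_ltW (leq_maxr _ _) Mv.
  - case: Xx => [->|[n [P [n_gt0 peakP ->]]]].
      exists 1%N; apply: cancelling_ltZ.
      by split; [apply: cancelling1 | apply: degree_lt1].
    exists n.+1; apply: cancelling_ltZ.
    by split; [apply: cancelling_peak_function | apply: degree_lt_peak_function].
move=> Mf; apply/spanE; elim: d f Mf => [|d IHd] f Mf.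
  have -> : f = 0 by apply/funext => m; apply: Mf.2.
  exact: span_over0.
have [r [rM rP]] := cancelling_lt_peel d.
have [v span_v /IHd span_fv] := rP f Mf; rewrite -(subrK v f).
apply: span_overD => //; move: v span_v {span_fv}.
apply: span_over_ind => [|u v|a x _ /rM[_ Xx]]; first exact: span_over0.
  exact: span_overD.
exact: span_over_gen.
Qed.

End PeakStarCharacterization.

(** * Layers modulo [lower_part], and freeness *)

Section Freeness.
Variables (K : fieldType) (two_neq0 : 2%:R != 0 :> K).
Implicit Types (f g : series K).

Definition lower_part (d : nat) : set (series K) :=
  @span_over (series K) (series K)^o (@Omega K) (@cancelling_lt K d).

Lemma lower_part0 d : lower_part d 0.
Proof. exact: (@span_over0 (series K) (series K)^o). Qed.

Lemma lower_part_gen d c f : Omega c -> cancelling_lt d f -> lower_part d (c * f).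
Proof. exact: (@span_over_gen (series K) (series K)^o). Qed.

Lemma lower_part_incl d f : cancelling_lt d f -> lower_part d f.
Proof. by move=> Mf; rewrite -[f]mul1r; apply: lower_part_gen => //; apply: Omega1. Qed.

Lemma lower_part_add d f g : lower_part d f -> lower_part d g -> lower_part d (f + g).
Proof.
apply: (@span_overD (series K) (series K)^o); first exact: Omega0.
exact: Omega_add.
Qed.

Lemma lower_partZ d a f : lower_part d f -> lower_part d (a *: f).
Proof.
move=> Vf; rewrite -[f]mul1r scalerAl.
apply: (@span_overZ (series K) (series K)^o) Vf => b Ob.
by rewrite -scalerAl mul1r; apply: OmegaZ.
Qed.

Lemma lower_partB d f g : lower_part d f -> lower_part d g -> lower_part d (f - g).
Proof.
by move=> Vf Vg; apply: lower_part_add => //; rewrite -scaleN1r; apply: lower_partZ.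
Qed.

Lemma lower_part_sum d (I : Type) (r : seq I) (P : pred I) (F : I -> series K) :
  (forall i, P i -> lower_part d (F i)) -> lower_part d (\sum_(i <- r | P i) F i).
Proof. by move=> VF; apply: big_ind => //; [apply: lower_part0 | apply: lower_part_add]. Qed.

Lemma cancelling_lt_hasse d k f : cancelling_lt d f -> cancelling_lt (d - k) (hasse 0 k f).
Proof. by move=> [canf fd]; split; [apply: cancelling_hasse | apply: degree_lt_hasse]. Qed.

(** By the Leibniz rule, as [hasse] preserves [Omega] and does not raise degrees. *)
Lemma lower_part_hasse d k f : lower_part d f -> lower_part d (hasse 0 k f).
Proof.
move: f; apply: (@span_over_ind (series K) (series K)^o) => [|u v Vu Vv|c x Oc Mx].
- by rewrite linear0; apply: lower_part0.
- by rewrite linearD; apply: lower_part_add.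
- rewrite [hasse _ _ _]hasseM; apply: lower_part_sum => j _.
  apply: lower_part_gen; first exact: Omega_hasse.
  by apply: cancelling_ltW (cancelling_lt_hasse _ Mx); apply: leq_subr.
Qed.

Definition layer_basis (d : nat) (s : {fset series K}) : Prop :=
  [/\ forall x, x \in s -> cancelling_lt d.+1 x,
      forall c : series K -> K,
        lower_part d (\sum_(x <- s) c x *: x) -> forall x, x \in s -> c x = 0 &
      forall f, cancelling_lt d.+1 f ->
        exists c : series K -> K, lower_part d (f - \sum_(x <- s) c x *: x)].

Lemma layer_basis_exists d : exists s, layer_basis d s.
Proof.
have [r [rM rP]] := cancelling_lt_peel two_neq0 d.
have [|s [sr indep gen]] := @basis_modulo K (series K) (lower_part d) r (lower_part0 d).
  by move=> a u v Vu Vv; apply: lower_part_add => //; apply: lower_partZ.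
exists s; split=> // [x /sr /rM[]//|f /rP[v span_v Mfv]].
suff [c Vc] : exists c : series K -> K, lower_part d (v - \sum_(x <- s) c x *: x).
  exists c; rewrite -[f](subrK v) -addrA; apply: lower_part_add => //.
  exact: lower_part_incl.
move: v span_v {Mfv}.
apply: span_over_ind => [|u v [b Vb] [c Vc]|a x _ /gen[c Vc]].
- exists (fun=> 0); rewrite big1 ?subr0 => [|x _]; first exact: lower_part0.
  by rewrite scale0r.
- exists (fun x => b x + c x); under eq_bigr do rewrite scalerDl.
  by rewrite big_split opprD addrACA; apply: lower_part_add.
- exists (fun x => a * c x); under eq_bigr do rewrite -scalerA.
  by rewrite -scaler_sumr -scalerBr; apply: lower_partZ.
Qed.

(* Taking the coefficients of powers of a new first variable in a relation
   leaves the top layer x fixed modulo lower_part, and lowers the degree of the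
   coefficients c x; by induction these are constants. *)
Lemma layer_basis_independent d s e (c : series K -> series K) : layer_basis d s ->
  (forall x, x \in s -> Omega (c x) /\ degree_lt e (c x)) ->
  lower_part d (\sum_(x <- s) c x * x) -> forall x, x \in s -> c x = 0.
Proof.
move=> [sM indep _]; elim/ltn_ind: e c => e IHe c cO Vc.
have hasse_c k x : (0 < k)%N -> x \in s -> hasse 0 k (c x) = 0.
  move=> k_gt0; have [e0|e_gt0] := posnP e.
    move=> xs; have [_ cx] := cO x xs; apply/funext => m; apply: cx; lia.
  move: x; apply: (IHe (e - k)%N _ (fun x => hasse 0 k (c x))); first lia.
    by move=> x /cO[Ox cx]; split; [apply: Omega_hasse | apply: degree_lt_hasse].
  have := lower_part_hasse k Vc; rewrite linear_sum /=.
  rewrite -[X in lower_part d X -> _](subrK (\sum_(x <- s) hasse 0 k (c x) * x)).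
  set top := \sum_(x <- s) hasse 0 k (c x) * x; set all_ := \sum_(x <- s) _.
  move=> Vall; suff Vdiff : lower_part d (all_ - top).
    by have := lower_partB Vall Vdiff; rewrite addrC addKr.
  (* The terms left contain [hasse 0 (k - j) x] with [j < k], which has degree less than [d]. *)
  rewrite /all_ /top -sumrB big_seq; apply: lower_part_sum => x xs.
  rewrite hasseM big_ord_recr /= subnn (sM x xs).1.1 addrK.
  apply: lower_part_sum => j _; apply: lower_part_gen.
    by apply: Omega_hasse; have [] := cO x xs.
  have := cancelling_lt_hasse (k - j) (sM x xs).
  by apply: cancelling_ltW; have := ltn_ord j; lia.
have c_const x : x \in s -> c x = c x mset0 *: 1.
  move=> xs; apply: hasse_eq0_const; first by have [/Omega_cancelling[]] := cO x xs.
  by move=> k k_gt0; apply: hasse_c.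
have c0 : forall x, x \in s -> c x mset0 = 0.
  apply: (indep (fun x => c x mset0)); move: Vc.
  rewrite (eq_big_seq (fun x => c x mset0 *: x)) // => x /c_const {1}->.
  by rewrite -scalerAl mul1r.
by move=> x xs; rewrite c_const // c0 // scale0r.
Qed.

Lemma uniform_degree_bound (r : seq (series K)) (c : series K -> series K) :
  (forall x, x \in r -> Omega (c x)) ->
  exists e, forall x, x \in r -> degree_lt e (c x).
Proof.
elim: r => [|y r IHr] cO; first by exists 0%N.
have [|e eP] := IHr; first by move=> x xr; apply: cO; rewrite inE xr orbT.
have [d dP] := Omega_bounded (cO y (mem_head _ _)).
exists (maxn d e) => x; rewrite inE => /orP[/eqP->|/eP].
  exact: degree_ltW (leq_maxl _ _) dP.
exact: degree_ltW (leq_maxr _ _).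
Qed.

Lemma PeakStar_free : free_module_over (@Omega K) (@PeakStar K).
Proof.
have /boolp.choice[b bP] := layer_basis_exists.
pose B : set (series K) := fun x => exists d, x \in b d.
exists B; split=> [s c sB rel|f].
  (* A layer is chosen for each element of [s], with the default 0 elsewhere. *)
  have /boolp.choice[idx idxP] : forall x, exists d, x \in s -> x \in b d.
    by move=> x; have [/sB[[d xd] _]|] := boolP (x \in s); [exists d | exists 0%N].
  (* Here [n] bounds the layers with a nonzero coefficient; each induction step removes the top
     one. *)
  suff vanish n : (forall x, x \in s -> c x != 0 -> (idx x < n)%N) ->
      forall x, x \in s -> c x = 0.
    apply: (vanish (\max_(x <- s) (idx x).+1)) => x xs _.
    exact: (leq_bigmax_seq (F := fun x => (idx x).+1)).
  elim: n => [|n IHn] idx_lt.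
    by move=> x xs; apply/eqP; apply/negPn/negP => /(idx_lt x xs).
  (* The part of the relation in layer [n]. *)
  pose c' x := if (x \in s) && (idx x == n) then c x else 0.
  have c'O x : Omega (c' x).
    by rewrite /c'; case: ifP => [/andP[/sB[]]|] //; move=> _; apply: Omega0.
  have c'_eq0 : forall x, x \in b n -> c' x = 0.
    have [e eP] := @uniform_degree_bound (b n) c' (fun x _ => c'O x).
    apply: (layer_basis_independent (bP n) (e := e)) => [x xb|]; first by split; [|apply: eP].
    have -> : \sum_(x <- b n) c' x * x = \sum_(x <- s) c' x * x.
      transitivity (\sum_(x <- (b n `|` s)%fset) c' x * x).
        apply: big_fset_incl; first exact: fsubsetUl.
        move=> x _ xbn; rewrite /c'; case: ifP => [/andP[xs /eqP def_n]|_]; last by rewrite mul0r.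
        by rewrite -def_n idxP in xbn.
      apply/esym; apply: big_fset_incl; first exact: fsubsetUr.
      by move=> x _ /negbTE xs; rewrite /c' xs mul0r.
    (* The rest of the relation lives in lower layers, hence in [lower_part n]. *)
    have -> : \sum_(x <- s) c' x * x = - \sum_(x <- s) (c x - c' x) * x.
      apply/eqP; rewrite -addr_eq0 -big_split /= -[X in _ == X]rel; apply/eqP.
      by apply: eq_bigr => x _; rewrite -mulrDl addrC subrK.
    rewrite -scaleN1r; apply: lower_partZ; rewrite big_seq; apply: lower_part_sum => x xs.
    rewrite /c' xs /=; have [def_n|neq_n] := eqVneq (idx x) n.
      by rewrite subrr mul0r; apply: lower_part0.
    rewrite subr0; have [->|cx0] := eqVneq (c x) 0.
      by rewrite mul0r; apply: lower_part0.
    apply: lower_part_gen; first by have [] := sB x xs.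
    have [bM _ _] := bP (idx x); have := bM x (idxP x xs).
    by apply: cancelling_ltW; have := idx_lt x xs cx0; rewrite ltnS ltn_neqAle neq_n.
  apply: IHn => x xs cx0; have := idx_lt x xs cx0; rewrite ltnS leq_eqVlt.
  case/orP=> // def_n; case/eqP: cx0; have := c'_eq0 x; rewrite /c' xs def_n /=.
  by apply; rewrite -(eqP def_n) idxP.
pose L := @span_over (series K) (series K)^o (@Omega K) B.
have LD u v : L u -> L v -> L (u + v).
  by apply: (@span_overD (series K) (series K)^o); [apply: Omega0 | apply: Omega_add].
have L0 : L 0 by apply: (@span_over0 (series K) (series K)^o).
have LM a u : Omega a -> L u -> L (a * u).
  by move=> Oa; apply: (@span_overZ (series K) (series K)^o) => e; apply: OmegaM.
transitivity (L f); last by split.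
rewrite PeakStarE //; split=> [[d]|].
  elim: d f => [|d IHd] f Mf.
    by have -> : f = 0 by apply/funext => m; apply: Mf.2.
  (* Modulo the layer [b d], [f] is an [Omega]-combination of elements of smaller degree, to which
     the induction hypothesis applies. *)
  have [bM _ gen] := bP d; have [c Vc] := gen f Mf.
  rewrite -(subrK (\sum_(x <- b d) c x *: x) f); apply: (LD).
    move: (f - _) Vc; apply: (@span_over_ind (series K) (series K)^o) => // a x Oa Mx.
    by apply: LM => //; apply: IHd.
  rewrite big_seq; apply: big_ind => // x xb.
  rewrite -[x]mul1r scalerAl; apply: (@span_over_gen (series K) (series K)^o).
    by apply: OmegaZ; apply: Omega1.
  by exists d.
move: f; apply: (@span_over_ind (series K) (series K)^o) => [|u v [d Mu] [e Mv]|a x Oa [d xd]].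
- by exists 0%N; apply: cancelling_lt0.
- exists (maxn d e); apply: cancelling_lt_add.
    exact: cancelling_ltW (leq_maxl _ _) Mu.
  exact: cancelling_ltW (leq_maxr _ _) Mv.
- have [bM _ _] := bP d; have [canx xdeg] := bM x xd; have [e aE] := Omega_bounded Oa.
  exists (e + d.+1)%N; split; last exact: degree_ltM.
  by apply: cancellingM => //; apply: Omega_cancelling.
Qed.

End Freeness.

Theorem proposition4p2p2 (K : closedFieldType) (charK0 : [pchar K] =i pred0) :
  free_module_over (@Omega K) (@PeakStar K).
Proof.
(* Characteristic 0 makes 2 invertible, so the diagonal of the triangular system is nonzero. *)
by apply: PeakStar_free; rewrite (pcharf0P K).1.
Qed.
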